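(* Let $g,h\in S_0(\mathbb{R})$ with $\langle g,h\rangle=1$, let $b_0,\nu_0>0$, put $\square=[0,\nu_0^{-1}[\times[0,b_0^{-1}[$, $\mathcal{V}=\mathcal{V}_gh$, and assume there exist constants $0<A\le B<\infty$ with $A\le\mathcal{U}(b,\nu)\le B$ for a.e. $(b,\nu)\in\square$, where $\mathcal{U}(b,\nu)=\sum_{k,\ell\in\mathbb{Z}}|\mathcal{V}(b+k/\nu_0,\nu+\ell/b_0)|^2$. Let $H$ be a Hilbert-Schmidt operator on $\mathbf{L}^2(\mathbb{R})$ with spreading function $\eta_H$, and let $\mathbb{M}_{\mathbf{m}}=\mathbb{M}^G_{\mathbf{m};g,h}$ be its best approximation in Hilbert-Schmidt norm by a Gabor multiplier with windows $g,h$ and lattice constants $b_0,\nu_0$, i.e. the Gabor multiplier whose transfer function $\mathbf{m}$ has discrete symplectic Fourier transform $$\mathcal{M}(b,\nu)=\frac{1}{\mathcal{U}(b,\nu)}\sum_{k,\ell\in\mathbb{Z}}\overline{\mathcal{V}}(b+k/\nu_0,\nu+\ell/b_0)\,\eta_H(b+k/\nu_0,\nu+\ell/b_0).$$ Set, for $(b,\nu)\in\square$, $$\mathcal{E}(b,\nu)=\frac{\left|\sum_{k,\ell}\eta_H(b+k/\nu_0,\nu+\ell/b_0)\overline{\mathcal{V}}(b+k/\nu_0,\nu+\ell/b_0)\right|^2}{\sum_{k,\ell}|\eta_H(b+k/\nu_0,\nu+\ell/b_0)|^2\;\mathcal{U}(b,\nu)} .$$ Then $$\|H-\mathbb{M}_{\mathbf{m}}\|_{HS}^2\le\|\eta_H\|^2_{\mathbf{L}^2(\mathbb{R}^2)}\,\|1-\mathcal{E}\|_\infty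 ,$$ where $\|\cdot\|_{HS}$ is the Hilbert-Schmidt norm and $\|\cdot\|_\infty$ is the essential supremum over the points of $\square$ at which $\mathcal{E}$ is defined (nonzero denominator).
   Context: Notation: $T_bf(t)=f(t-b)$, $M_\nu f(t)=e^{2i\pi\nu t}f(t)$, $\pi(b,\nu)=M_\nu T_b$, $\mathcal{V}_gf(b,\nu)=\langle f,\pi(b,\nu)g\rangle$ (antilinear in the second slot). $S_0(\mathbb{R})=\{f\in\mathbf{L}^2(\mathbb{R}):\|\mathcal{V}_\varphi f\|_{\mathbf{L}^1(\mathbb{R}^2)}<\infty\}$ ($\varphi\neq0$ a fixed Schwartz function). Gabor multiplier: $\mathbb{M}^G_{\mathbf{m};g,h}f=\sum_{m,n\in\mathbb{Z}}\mathbf{m}(m,n)\mathcal{V}_gf(mb_0,n\nu_0)\,\pi(mb_0,n\nu_0)h$ with $\mathbf{m}\in\ell^2(\mathbb{Z}^2)$. Discrete symplectic Fourier transform: $\mathcal{M}(t,\xi)=\sum_{m,n}\mathbf{m}(m,n)e^{2i\pi(n\nu_0t-mb_0\xi)}$. The spreading function of a Hilbert-Schmidt operator with integral kernel $\kappa_H$ is $\eta_H(b,\nu)=\int\kappa_H(t,t-b)e^{-2i\pi\nu t}dt\in\mathbf{L}^2(\mathbb{R}^2)$. The essential supremum over a null set is taken to be $0$. *)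

(* Defs.v *)
From HB Require Import structures.
From mathcomp Require Import all_boot all_order all_algebra.
From mathcomp Require Import all_classical all_reals all_analysis.
From mathcomp Require Import ess_sup_inf complex.

Set Implicit Arguments.
Unset Strict Implicit.
Unset Printing Implicit Defensive.

Import Order.TTheory GRing.Theory Num.Theory.
Import numFieldNormedType.Exports.

Local Open Scope classical_set_scope.
Local Open Scope ring_scope.

(* MathComp-Analysis, over an arbitrary [R : realType]; complex scalars are
   [R[i]].  Elements of L^2 are represented by measurable functions, equality
   in L^2 being equality almost everywhere. *)

Section ComplexIntegration.
Context d (T : measurableType d) (R : realType).
Variable mu : {measure set T -> \bar R}.
Implicit Types (D : set T) (f : T -> R[i]).

Definition cmeasurable f :=
  measurable_fun [set: T] (fun x => complex.Re (f x)) /\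
  measurable_fun [set: T] (fun x => complex.Im (f x)).

Definition cintegral D f : R[i] :=
  (\int[mu]_(x in D) complex.Re (f x) +i* \int[mu]_(x in D) complex.Im (f x))%C.

(* squared L^2(D) norm *)
Definition L2normsq D f : \bar R :=
  (\int[mu]_(x in D) (Normc.normc (f x) ^+ 2)%:E)%E.

Definition inL2 f := cmeasurable f /\ (L2normsq setT f < +oo)%E.

Definition L2cvg D (F : nat -> T -> R[i]) f :=
  L2normsq D (fun x => F n x - f x) @[n --> \oo] --> 0%E.

End ComplexIntegration.

Notation leb := (@lebesgue_measure _).
Notation leb2 := ((@lebesgue_measure _) \x (@lebesgue_measure _))%E.

Section Sums.
Context (R : realType).

Definition square_sum (V : nmodType) (F : int -> int -> V) (N : nat) : V :=
  \sum_(i < (2 * N).+1) \sum_(j < (2 * N).+1)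
    F (i%:Z - N%:Z) (j%:Z - N%:Z).

(* sum over Z^2 of nonnegative terms, possibly infinite *)
Definition nnsumZ2 (F : int -> int -> R) : \bar R :=
  (\esum_(k in [set: int * int]) (F k.1 k.2)%:E)%E.

(* sum over Z^2 of an absolutely summable family (junk otherwise) *)
Definition rsumZ2 (F : int -> int -> R) : R :=
  fine (nnsumZ2 (fun k l => Num.max (F k l) 0)) -
  fine (nnsumZ2 (fun k l => Num.max (- F k l) 0)).

Definition csumZ2 (F : int -> int -> R[i]) : R[i] :=
  (rsumZ2 (fun k l => complex.Re (F k l)) +i*
   rsumZ2 (fun k l => complex.Im (F k l)))%C.

Definition ell2 (m : int -> int -> R[i]) :=
  (nnsumZ2 (fun k l => Normc.normc (m k l) ^+ 2)%R < +oo)%E.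

End Sums.

Section TimeFrequency.
Context (R : realType).
Implicit Types (f g h phi : R -> R[i]) (b nu t : R).

(* e^{2 i pi x} *)
Definition e2ipi (x : R) : R[i] :=
  (cos (2 * pi * x) +i* sin (2 * pi * x))%C.

Definition translation b f t := f (t - b).
Definition modulation nu f t := e2ipi (nu * t) * f t.
Definition tfshift b nu f := modulation nu (translation b f).

Definition inner f g : R[i] :=
  cintegral leb setT (fun t => f t * conjc (g t)).

(* V_g f *)
Definition stft g f (x : R * R) : R[i] := inner f (tfshift x.1 x.2 g).

Definition real_schwartz (u : R -> R) :=
  (forall n t, derivable (derive1n n u) t 1) /\
  (forall k n : nat, exists C, forall t, `|t ^+ k * derive1n n u t| <= C).

Definition schwartz phi :=
  real_schwartz (fun t => complex.Re (phi t)) /\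
  real_schwartz (fun t => complex.Im (phi t)).

(* Feichtinger algebra, phi being the reference Schwartz window. *)
Definition S0 phi f :=
  inL2 leb f /\
  (\int[leb2]_x (Normc.normc (stft phi f x))%:E < +oo)%E.

End TimeFrequency.

Section Operators.
Context (R : realType).
Implicit Types (H M : (R -> R[i]) -> R -> R[i]) (e : nat -> R -> R[i]).

(* Only the action on square-integrable functions matters; linearity and
   boundedness make the action compatible with a.e. equality. *)
Definition bounded_operator H :=
  [/\ forall f, inL2 leb f -> inL2 leb (H f),
      forall (a : R[i]) f g, inL2 leb f -> inL2 leb g ->
        {ae leb, forall t, H (fun s => a * f s + g s) t = a * H f t + H g t}
    & exists K : R, forall f, inL2 leb f ->
        (L2normsq leb setT (H f) <= K%:E * L2normsq leb setT f)%E].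

Definition orthonormal_basis e :=
  [/\ forall n, inL2 leb (e n),
      forall i j, inner (e i) (e j) = (i == j)%:R
    & forall f, inL2 leb f ->
        L2cvg leb setT
          (fun N t => \sum_(n < N) inner f (e n) * e n t) f].

(* sum_n ||H e_n||^2 does not depend on the orthonormal basis e of L^2(R), so
   the supremum below is over a family with a single value. *)
Definition HSnormsq H : \bar R :=
  ereal_sup [set (\sum_(0 <= n <oo) L2normsq leb setT (H (e n)))%E
            | e in orthonormal_basis].

Definition hilbert_schmidt H :=
  bounded_operator H /\ (HSnormsq H < +oo)%E.

Definition integral_kernel H (kappa : R * R -> R[i]) :=
  inL2 leb2 kappa /\
  forall f, inL2 leb f ->
    {ae leb, forall t, H f t = cintegral leb setT (fun s => kappa (t, s) * f s)}.

(* As kappa is merely in L^2(R^2), the integral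
     eta(b, nu) = int kappa(t, t - b) e^{-2 i pi nu t} dt
   is a Fourier transform in the sense of L^2: the limit in L^2(R^2) of the
   integrals truncated to [-N, N]. *)
Definition spreading_function H (eta : R * R -> R[i]) :=
  inL2 leb2 eta /\
  exists2 kappa, integral_kernel H kappa &
    L2cvg leb2 setT
      (fun N x => cintegral leb `[- N%:R, N%:R]
         (fun t => kappa (t, t - x.1) * e2ipi (- (x.2 * t))))
      eta.

(* M f is the sum, in the L^2 sense, of the series
     sum_{k,l} m(k,l) V_g f(k b0, l nu0) pi(k b0, l nu0) h. *)
Definition gabor_multiplier (b0 nu0 : R) (m : int -> int -> R[i])
    (g h : R -> R[i]) M :=
  forall f, inL2 leb f ->
    inL2 leb (M f) /\
    L2cvg leb setT
      (fun N t => square_sum (fun k l =>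
         m k l * stft g f (k%:~R * b0, l%:~R * nu0) *
         tfshift (k%:~R * b0) (l%:~R * nu0) h t) N)
      (M f).

End Operators.

Section Periodization.
Context (R : realType) (b0 nu0 : R).
Implicit Types (V eta : R * R -> R[i]) (x : R * R) (m : int -> int -> R[i]).

Definition cell : set (R * R) := `[0, nu0^-1[ `*` `[0, b0^-1[.

(* Mt = sum_{k,l} m(k,l) e^{2 i pi (l nu0 t - k b0 xi)}: for m in l^2(Z^2) the
   series converges in L^2(cell), cell being a common period of its terms, and
   Mt is determined by m up to a null set. *)
Definition symplectic_fourier m (Mt : R * R -> R[i]) :=
  L2cvg leb2 cell
    (fun N x => square_sum (fun k l =>
       m k l * e2ipi (l%:~R * nu0 * x.1 - k%:~R * b0 * x.2)) N)
    Mt.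

Definition adjshift x (k l : int) : R * R :=
  (x.1 + k%:~R / nu0, x.2 + l%:~R / b0).

Definition periodized_normsq V x : \bar R :=
  nnsumZ2 (fun k l => Normc.normc (V (adjshift x k l)) ^+ 2).

Definition periodized_inner eta V x : R[i] :=
  csumZ2 (fun k l => eta (adjshift x k l) * conjc (V (adjshift x k l))).

(* Discrete symplectic Fourier transform of the transfer function of the Gabor
   multiplier closest to the operator with spreading function eta. *)
Definition best_transfer V eta x : R[i] :=
  ((fine (periodized_normsq V x))^-1)%:C%C * periodized_inner eta V x.

(* Infinite only on a null set when V is V_g h with a bounded periodization and
   eta is in L^2(R^2). *)
Definition Eden V eta x : \bar R :=
  (periodized_normsq eta x * periodized_normsq V x)%E.

Definition Efun V eta x : R :=
  Normc.normc (periodized_inner eta V x) ^+ 2 / fine (Eden V eta x).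

Definition Edom V eta : set (R * R) :=
  [set x | cell x /\ Eden V eta x <> 0%E].

End Periodization.

(* Essential supremum over D of a nonnegative function u; extending u by 0 gives
   the value 0 when D is a null set and does not change it otherwise. *)
Definition ess_sup_on d (T : measurableType d) (R : realType)
    (mu : {measure set T -> \bar R}) (D : set T) (u : T -> R) : \bar R :=
  ess_sup mu (fun x => if x \in D then (u x)%:E else 0%E).

(* Main.v *)
Require Import Defs.
From HB Require Import structures.
From mathcomp Require Import all_boot all_order all_algebra.
From mathcomp Require Import all_classical all_reals all_analysis.
From mathcomp Require Import ess_sup_inf measurable_realfun complex.
From mathcomp Require Import ring lra.

(** A Hilbert-Schmidt operator is determined by its spreading function, and the map
from operators to spreading functions is an isometry: on each diagonal [t - s = b]
of the kernel it is the one-dimensional Fourier transform. The spreading function of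
the Gabor multiplier with transfer function [m] is [M V], where [M] is the symplectic
Fourier transform of [m], periodic with respect to the adjoint lattice, and [V] is
the short-time Fourier transform of [h] with window [g]. So the squared error is the
squared L2 norm of [eta - M V]. Cutting the plane into translates of the cell, this
is the integral over the cell of the squared distance, in l2(Z^2), between the
fibre of [eta] and [M] times the fibre of [V]. The prescribed [M] is the coefficient
of the orthogonal projection of the former fibre on the latter, so Pythagoras gives
the distance [S (1 - E)], where [S] is the squared norm of the fibre of [eta]. The
integral of [S] is the squared norm of [eta], and the theorem follows.

Only one half of each isometry is used. For the Hilbert-Schmidt norm,
[sum_L2normsq_le_kernel] bounds the sum over an orthonormal family by the squared
norm of the kernel, by Bessel's inequality on almost every section. For the
spreading function, [kernel_le_spreading] bounds the norm of a kernel by the norm of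
its spreading function. It rests on the inequality [plancherel_le] for functions in
L1 and L2, which is proved with the Poisson kernel as an approximate identity and
the continuity of translations in L2, [L2_translate_near].

The multiplier and the symbol are limits of square partial sums, in the strong sense
and in L2 of the cell respectively. The partial sums have explicit kernels of finite
rank and explicit trigonometric symbols ([fourier_diagonal_gabor_kernel]), to which
the argument above applies, and [le_limit_young] passes to the limit. The fibrewise
part is [nnsumZ2_projection] and [spreading_residual_le], the decomposition into
fibres [integral_periodize]. *)

Set Implicit Arguments.
Unset Strict Implicit.
Unset Printing Implicit Defensive.

Import Order.TTheory GRing.Theory Num.Theory.
Import numFieldNormedType.Exports.

Local Open Scope classical_set_scope.
Local Open Scope ring_scope.

(** * Complex numbers *)

Lemma normM_le_sq (R : realDomainType) (x y : R) : `|x * y| <= x ^+ 2 + y ^+ 2.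
Proof.
rewrite ler_norml; have := sqr_ge0 (x - y); have := sqr_ge0 (x + y).
by rewrite sqrrB sqrrD => *; apply/andP; split; nra.
Qed.

Lemma norm_det_le (R : realDomainType) (a b c d : R) :
  `|a * c - b * d| <= a ^+ 2 + b ^+ 2 + (c ^+ 2 + d ^+ 2).
Proof.
rewrite addrACA; apply: le_trans (ler_normB _ _) _.
by apply: lerD; exact: normM_le_sq.
Qed.

Section Complex.
Context (R : realType).
Implicit Types z w : R[i].

Lemma normc_sq z : Normc.normc z ^+ 2 = complex.Re z ^+ 2 + complex.Im z ^+ 2.
Proof. by case: z => a b /=; rewrite sqr_sqrtr// addr_ge0 ?sqr_ge0. Qed.

Lemma ReD z w : complex.Re (z + w) = complex.Re z + complex.Re w.
Proof. by case: z; case: w. Qed.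
Lemma ImD z w : complex.Im (z + w) = complex.Im z + complex.Im w.
Proof. by case: z; case: w. Qed.
Lemma ReN z : complex.Re (- z) = - complex.Re z. Proof. by case: z. Qed.
Lemma ImN z : complex.Im (- z) = - complex.Im z. Proof. by case: z. Qed.
Lemma ReM z w : complex.Re (z * w) =
  complex.Re z * complex.Re w - complex.Im z * complex.Im w.
Proof. by case: z; case: w. Qed.
Lemma ImM z w : complex.Im (z * w) =
  complex.Re z * complex.Im w + complex.Im z * complex.Re w.
Proof. by case: z; case: w. Qed.
Lemma ReJ z : complex.Re (conjc z) = complex.Re z. Proof. by case: z. Qed.
Lemma ImJ z : complex.Im (conjc z) = - complex.Im z. Proof. by case: z. Qed.

Definition ReImE := (ReD, ImD, ReN, ImN, ReM, ImM, ReJ, ImJ).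

Lemma complex_eq z w :
  complex.Re z = complex.Re w -> complex.Im z = complex.Im w -> z = w.
Proof. by case: z; case: w => ? ? ? ? /= -> ->. Qed.

Lemma conjcB z w : conjc (z - w) = conjc z - conjc w.
Proof. exact: raddfB. Qed.

Lemma conjcM z w : conjc (z * w) = conjc z * conjc w.
Proof. exact: rmorphM. Qed.

Lemma mulrJ_normc_sq z :
  z * conjc z = (Normc.normc z ^+ 2)%:C%C.
Proof. by rewrite normc_sq; case: z => a b; apply: complex_eq => /=; ring. Qed.

Lemma normc_sqJ z : Normc.normc (conjc z) ^+ 2 = Normc.normc z ^+ 2.
Proof. by rewrite !normc_sq ReJ ImJ sqrrN. Qed.

Lemma normc_sqM z w :
  Normc.normc (z * w) ^+ 2 = Normc.normc z ^+ 2 * Normc.normc w ^+ 2.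
Proof. by rewrite !normc_sq !ReImE; ring. Qed.

Lemma normc_sqN z : Normc.normc (- z) ^+ 2 = Normc.normc z ^+ 2.
Proof. by rewrite !normc_sq !ReImE !sqrrN. Qed.

Lemma sqrD_young (e x y : R) : 0 < e ->
  (x + y) ^+ 2 <= (1 + e) * x ^+ 2 + (1 + e^-1) * y ^+ 2.
Proof.
move=> e0; rewrite -subr_ge0.
have -> : (1 + e) * x ^+ 2 + (1 + e^-1) * y ^+ 2 - (x + y) ^+ 2 =
    e^-1 * (e * x - y) ^+ 2 by field; rewrite gt_eqF.
by rewrite mulr_ge0 ?sqr_ge0// invr_ge0 ltW.
Qed.

Lemma normc_sqD_young (e : R) z w : 0 < e -> Normc.normc (z + w) ^+ 2 <=
  (1 + e) * Normc.normc z ^+ 2 + (1 + e^-1) * Normc.normc w ^+ 2.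
Proof.
move=> e0; rewrite !normc_sq !ReImE !mulrDr addrACA.
by apply: lerD; exact: sqrD_young.
Qed.

Lemma e2ipiD (x y : R) : e2ipi (x + y) = e2ipi x * e2ipi y.
Proof.
apply: complex_eq; rewrite /e2ipi ?ReM ?ImM /= mulrDr ?cosD ?sinD//.
exact: addrC.
Qed.

Lemma e2ipiN (x : R) : e2ipi (- x) = conjc (e2ipi x).
Proof. by apply: complex_eq; rewrite /e2ipi /= mulrN ?cosN ?sinN. Qed.

Lemma normc_sq_e2ipi (x : R) : Normc.normc (e2ipi x) ^+ 2 = 1.
Proof. by rewrite normc_sq /= cos2Dsin2. Qed.

Lemma e2ipi_nat (n : nat) : e2ipi (n%:R : R) = 1.
Proof.
elim: n => [|n IH]; first by rewrite /e2ipi mulr0 cos0 sin0.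
rewrite -natr1 e2ipiD IH mul1r /e2ipi mulr1.
by rewrite (mulrC 2) (mulr_natr pi 2) cos2pi sin2pi.
Qed.

Lemma e2ipi_int (n : int) : e2ipi (n%:~R : R) = 1.
Proof.
case: n => n; first exact: e2ipi_nat.
by rewrite NegzE mulrNz e2ipiN e2ipi_nat; apply: complex_eq; rewrite //= oppr0.
Qed.

End Complex.

(** * Limits and almost everywhere properties *)

Lemma cvge0_near (R : realType) (u : nat -> \bar R) (d : R) :
  (u n @[n --> \oo] --> 0)%E -> 0 < d ->
  exists N, forall n, (N <= n)%N -> (u n < d%:E)%E.
Proof.
move=> u0 d0; have d0' : (0 < d%:E)%E by rewrite lte_fin.
by have [N _ HN] := u0 _ (open_ereal_lt' d0'); exists N => n /HN.
Qed.

Lemma ae_imply2 d (T : measurableType d) (R : realType)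
    (mu : {measure set T -> \bar R}) (P Q S : T -> Prop) :
  (forall x, P x -> Q x -> S x) -> {ae mu, forall x, P x} ->
  {ae mu, forall x, Q x} -> {ae mu, forall x, S x}.
Proof. by move=> PQS; apply: filterS2. Qed.

(** The squared-norm version of the fact that an inequality between norms passes
to the limit, the triangle inequality being replaced by Young's inequality. *)
Lemma le_limit_young (R : realType) (X Y : \bar R) (Xn Yn Z W : nat -> \bar R) :
  (0 <= Y)%E ->
  (forall (e : R) n, (0 < e)%R -> X <= (1 + e)%:E * Xn n + (1 + e^-1)%:E * Z n)%E ->
  (forall n, Xn n <= Yn n)%E ->
  (forall (e : R) n, (0 < e)%R -> Yn n <= (1 + e)%:E * Y + (1 + e^-1)%:E * W n)%E ->
  (Z n @[n --> \oo] --> 0)%E -> (W n @[n --> \oo] --> 0)%E -> (X <= Y)%E.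
Proof.
move=> Y0 hX hXY hY hZ hW.
case: Y Y0 hY => [y| |//]; last by move=> *; rewrite leey.
rewrite lee_fin => y0 hY; apply/lee_addgt0Pr => d d0.
(* As e <= 1, (1 + e) ^ 2 y <= y + 3 e y; the terms Z and W are made so small that
they contribute e in total. *)
pose e := Num.min 1 (d / (3 * y + 1)).
have y1 : 0 < 3 * y + 1 by rewrite ltr_wpDl// mulr_ge0.
have e0 : 0 < e by rewrite lt_min ltr01/= divr_gt0.
have e1 : e <= 1 by rewrite ge_min lexx.
have ed : e * (3 * y + 1) <= d.
  by rewrite -ler_pdivlMr// ge_min lexx orbT.
move: e e0 e1 ed => e e0 e1 ed.
have i0 : 0 < 1 + e^-1 by rewrite addr_gt0 ?invr_gt0.
pose c := (1 + e) * (1 + e^-1) + (1 + e^-1).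
have c0 : 0 < c by rewrite addr_gt0// mulr_gt0// addr_gt0.
have ec0 : 0 < e / c by rewrite divr_gt0.
have [N1 HN1] := cvge0_near hZ ec0; have [N2 HN2] := cvge0_near hW ec0.
pose n := maxn N1 N2.
have Zn := HN1 n (leq_maxl _ _); have Wn := HN2 n (leq_maxr _ _).
apply: (le_trans (hX e n e0)).
apply: (@le_trans _ _ ((1 + e)%:E * ((1 + e)%:E * y%:E + (1 + e^-1)%:E * (e / c)%:E) +
    (1 + e^-1)%:E * (e / c)%:E)%E).
  apply: leeD; last first.
    by apply: lee_wpmul2l; [rewrite lee_fin ltW|exact: ltW].
  apply: lee_wpmul2l; first by rewrite lee_fin addr_ge0 ?ltW.
  apply: (le_trans (hXY n)); apply: (le_trans (hY e n e0)); apply: leeD => //.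
  by apply: lee_wpmul2l; [rewrite lee_fin ltW|exact: ltW].
rewrite -!EFinM -!EFinD lee_fin.
rewrite [leLHS](_ : _ = (1 + e) ^+ 2 * y + c * (e / c)); last by rewrite /c; ring.
rewrite mulrCA divff ?gt_eqF// mulr1.
have : e * e * y <= e * y by rewrite ler_wpM2r// ler_piMl// ltW.
by move: ed; lra.
Qed.

(** * Measurability, integrals and L2 norms of complex functions *)

Section ComplexMeasurability.
Context d (T : measurableType d) (R : realType).
Implicit Types (f g : T -> R[i]).

Lemma cmeasurableD f g : cmeasurable f -> cmeasurable g ->
  cmeasurable (fun x => f x + g x).
Proof.
move=> [f1 f2] [g1 g2]; split.
- by under eq_fun do rewrite ReD; exact: measurable_funD.
- by under eq_fun do rewrite ImD; exact: measurable_funD.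
Qed.

Lemma cmeasurableN f : cmeasurable f -> cmeasurable (fun x => - f x).
Proof.
move=> [f1 f2]; split.
- by under eq_fun do rewrite ReN; exact: measurableT_comp.
- by under eq_fun do rewrite ImN; exact: measurableT_comp.
Qed.

Lemma cmeasurableB f g : cmeasurable f -> cmeasurable g ->
  cmeasurable (fun x => f x - g x).
Proof. by move=> mf mg; apply: cmeasurableD => //; exact: cmeasurableN. Qed.

Lemma cmeasurableM f g : cmeasurable f -> cmeasurable g ->
  cmeasurable (fun x => f x * g x).
Proof.
move=> [f1 f2] [g1 g2]; split.
- under eq_fun do rewrite ReM.
  by apply: measurable_funB; exact: measurable_funM.
- under eq_fun do rewrite ImM.
  by apply: measurable_funD; exact: measurable_funM.
Qed.

Lemma cmeasurableJ f : cmeasurable f -> cmeasurable (fun x => conjc (f x)).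
Proof.
move=> [f1 f2]; split; first by under eq_fun do rewrite ReJ.
by under eq_fun do rewrite ImJ; exact: measurableT_comp.
Qed.

Lemma cmeasurable_cst (c : R[i]) : cmeasurable (fun _ : T => c).
Proof. by split; exact: measurable_cst. Qed.

Lemma cmeasurable_sum I (r : seq I) (F : I -> T -> R[i]) :
  (forall i, cmeasurable (F i)) -> cmeasurable (fun x => \sum_(i <- r) F i x).
Proof.
move=> mF; elim: r => [|i r IH].
  by under eq_fun do rewrite big_nil; exact: cmeasurable_cst.
by under eq_fun do rewrite big_cons; exact: cmeasurableD.
Qed.

Lemma cmeasurable_e2ipi (u : T -> R) :
  measurable_fun setT u -> cmeasurable (fun x => e2ipi (u x)).
Proof.
move=> mu; have m2u : measurable_fun setT (fun x => 2 * pi * u x).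
  by apply: measurable_funM => //; exact: measurable_cst.
split => /=.
- by apply: measurableT_comp m2u; apply: continuous_measurable_fun; exact: continuous_cos.
- by apply: measurableT_comp m2u; apply: continuous_measurable_fun; exact: continuous_sin.
Qed.

Lemma measurable_normc_sq f : cmeasurable f ->
  measurable_fun setT (fun x => Normc.normc (f x) ^+ 2).
Proof.
move=> [f1 f2]; under eq_fun do rewrite normc_sq.
by apply: measurable_funD; exact: measurable_funX.
Qed.

Lemma measurable_normc_sqE f : cmeasurable f ->
  measurable_fun setT (fun x => (Normc.normc (f x) ^+ 2)%:E).
Proof. by move=> mf; apply/measurable_EFinP; exact: measurable_normc_sq. Qed.

End ComplexMeasurability.

Lemma cmeasurable_comp d d' (T : measurableType d) (S : measurableType d')
    (R : realType) (f : S -> R[i]) (u : T -> S) :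
  cmeasurable f -> measurable_fun setT u -> cmeasurable (fun x => f (u x)).
Proof.
by move=> [f1 f2] mu; split;
  [exact: measurableT_comp f1 mu | exact: measurableT_comp f2 mu].
Qed.

Section ComplexIntegral.
Context d (T : measurableType d) (R : realType).
Variable mu : {measure set T -> \bar R}.
Implicit Types (f g : T -> R[i]) (D : set T).

Definition cintegrable D f :=
  mu.-integrable D (fun x => (complex.Re (f x))%:E) /\
  mu.-integrable D (fun x => (complex.Im (f x))%:E).

Lemma cintegrableD D f g : measurable D -> cintegrable D f ->
  cintegrable D g -> cintegrable D (fun x => f x + g x).
Proof.
move=> mD [f1 f2] [g1 g2]; split.
- by under eq_fun do rewrite ReD EFinD; exact: integrableD.
- by under eq_fun do rewrite ImD EFinD; exact: integrableD.
Qed.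

Lemma cintegrableZ D (c : R[i]) f : measurable D -> cintegrable D f ->
  cintegrable D (fun x => c * f x).
Proof.
move=> mD [f1 f2]; split.
- under eq_fun do rewrite ReM EFinB !EFinM.
  by apply: integrableB => //; exact: integrableZl.
- under eq_fun do rewrite ImM EFinD !EFinM.
  by apply: integrableD => //; exact: integrableZl.
Qed.

Lemma cintegral_eq D f g : {in D, f =1 g} ->
  cintegral mu D f = cintegral mu D g.
Proof.
by move=> fg; rewrite /cintegral; congr (_ +i* _)%C;
  apply: eq_Rintegral => x xD; rewrite fg.
Qed.

Lemma cintegralD D f g : measurable D -> cintegrable D f ->
  cintegrable D g ->
  cintegral mu D (fun x => f x + g x) = cintegral mu D f + cintegral mu D g.
Proof.
move=> mD [f1 f2] [g1 g2]; apply: complex_eq; rewrite ?ReD ?ImD /cintegral /=.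
- by under eq_Rintegral do rewrite ReD; rewrite RintegralD.
- by under eq_Rintegral do rewrite ImD; rewrite RintegralD.
Qed.

Lemma cintegralZ D (c : R[i]) f : measurable D -> cintegrable D f ->
  cintegral mu D (fun x => c * f x) = c * cintegral mu D f.
Proof.
move=> mD [f1 f2].
have i1 (a : R) : mu.-integrable D (EFin \o (fun x => a * complex.Re (f x))).
  by rewrite /comp; under eq_fun do rewrite EFinM; exact: integrableZl.
have i2 (a : R) : mu.-integrable D (EFin \o (fun x => a * complex.Im (f x))).
  by rewrite /comp; under eq_fun do rewrite EFinM; exact: integrableZl.
apply: complex_eq; rewrite ?ReM ?ImM /cintegral /=.
- by under eq_Rintegral do rewrite ReM; rewrite RintegralB// !RintegralZl.
- by under eq_Rintegral do rewrite ImM; rewrite RintegralD// !RintegralZl.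
Qed.

Lemma cintegral_sum D I (r : seq I) (F : I -> T -> R[i]) : measurable D ->
  (forall i, cintegrable D (F i)) ->
  cintegrable D (fun x => \sum_(i <- r) F i x) /\
  cintegral mu D (fun x => \sum_(i <- r) F i x) =
    \sum_(i <- r) cintegral mu D (F i).
Proof.
move=> mD iF; elim: r => [|i r [IH1 IH2]].
  have -> : (fun x => \sum_(i <- [::]) F i x) = (fun=> 0).
    by apply/funext => x; rewrite big_nil.
  rewrite big_nil; split; first by split; exact: integrable0.
  by apply: complex_eq; rewrite /cintegral /= Rintegral_cst// mul0r.
have -> : (fun x => \sum_(i <- i :: r) F i x) =
    (fun x => F i x + \sum_(i <- r) F i x).
  by apply/funext => x; rewrite big_cons.
by rewrite big_cons; split; [exact: cintegrableD|rewrite cintegralD// IH2].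
Qed.

Lemma cintegralJ D f : measurable D -> cintegrable D f ->
  cintegral mu D (fun x => conjc (f x)) = conjc (cintegral mu D f).
Proof.
move=> mD [f1 f2]; apply: complex_eq; rewrite ?ReJ ?ImJ /cintegral /=.
- by under eq_Rintegral do rewrite ReJ.
- under eq_Rintegral do rewrite ImJ -mulN1r.
  by rewrite RintegralZl// mulN1r.
Qed.

Lemma L2normsq_ge0 D f : (0 <= L2normsq mu D f)%E.
Proof. by apply: integral_ge0 => x _; rewrite lee_fin sqr_ge0. Qed.

(** Young's inequality stands in for the triangle inequality of the L2 norm: it
keeps squared norms, hence sums and integrals of them, on both sides. *)
Lemma L2normsq_young D (e : R) f g : measurable D -> 0 < e ->
  cmeasurable f -> cmeasurable g ->
  (L2normsq mu D (fun x => (f x + g x)%R) <=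
   (1 + e)%:E * L2normsq mu D f + (1 + e^-1)%:E * L2normsq mu D g)%E.
Proof.
move=> mD e0 mf mg; rewrite /L2normsq.
have e1 : 0 <= 1 + e by rewrite addr_ge0// ltW.
have e2 : 0 <= 1 + e^-1 by rewrite addr_ge0// invr_ge0 ltW.
have mf2 : measurable_fun D (fun x => (Normc.normc (f x) ^+ 2)%:E).
  by apply: measurable_funTS; exact: measurable_normc_sqE.
have mg2 : measurable_fun D (fun x => (Normc.normc (g x) ^+ 2)%:E).
  by apply: measurable_funTS; exact: measurable_normc_sqE.
rewrite -!ge0_integralZl//; try by move=> x _; rewrite lee_fin sqr_ge0.
rewrite -ge0_integralD//; first last.
- exact: measurable_funeM.
- by move=> x _; rewrite -EFinM lee_fin mulr_ge0// sqr_ge0.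
- exact: measurable_funeM.
- by move=> x _; rewrite -EFinM lee_fin mulr_ge0// sqr_ge0.
apply: ge0_le_integral => //.
- by move=> x _; rewrite lee_fin sqr_ge0.
- apply: measurable_funTS; apply: measurable_normc_sqE; exact: cmeasurableD.
- by apply: emeasurable_funD; exact: measurable_funeM.
- by move=> x _; rewrite -!EFinM -EFinD lee_fin; exact: normc_sqD_young.
Qed.

Lemma L2normsqN D f : L2normsq mu D (fun x => - f x) = L2normsq mu D f.
Proof. by apply: eq_integral => x _; rewrite normc_sqN. Qed.

Lemma inL2D f g : inL2 mu f -> inL2 mu g -> inL2 mu (fun x => f x + g x).
Proof.
move=> [mf f2] [mg g2]; split; first exact: cmeasurableD.
apply: le_lt_trans (L2normsq_young measurableT ltr01 mf mg) _.
by rewrite lte_add_pinfty// lte_mul_pinfty// lee_fin; lra.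
Qed.

Lemma inL2N f : inL2 mu f -> inL2 mu (fun x => - f x).
Proof. by move=> [mf f2]; split; [exact: cmeasurableN|rewrite L2normsqN]. Qed.

Lemma inL2B f g : inL2 mu f -> inL2 mu g -> inL2 mu (fun x => f x - g x).
Proof. by move=> mf mg; apply: inL2D => //; exact: inL2N. Qed.

Lemma L2normsqZ D (c : R[i]) f : measurable D -> cmeasurable f ->
  L2normsq mu D (fun x => c * f x) =
  ((Normc.normc c ^+ 2)%:E * L2normsq mu D f)%E.
Proof.
move=> mD mf; rewrite /L2normsq -ge0_integralZl//.
- by apply: eq_integral => x _; rewrite normc_sqM EFinM.
- by apply: measurable_funTS; exact: measurable_normc_sqE.
- by move=> x _; rewrite lee_fin sqr_ge0.
- by rewrite lee_fin sqr_ge0.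
Qed.

Lemma inL2Z (c : R[i]) f : inL2 mu f -> inL2 mu (fun x => c * f x).
Proof.
move=> [mf f2]; split.
  by apply: cmeasurableM => //; exact: cmeasurable_cst.
by rewrite L2normsqZ// lte_mul_pinfty// lee_fin sqr_ge0.
Qed.

Lemma inL2J f : inL2 mu f -> inL2 mu (fun x => conjc (f x)).
Proof.
move=> [mf f2]; split; first exact: cmeasurableJ.
by rewrite /L2normsq; under eq_integral do rewrite normc_sqJ.
Qed.

Lemma inL2_0 : inL2 mu (fun=> 0).
Proof.
split; first exact: cmeasurable_cst.
rewrite /L2normsq (eq_integral (cst 0%E)) ?integral0//.
by move=> x _; rewrite normc_sq /= expr0n /= addr0.
Qed.

Lemma inL2_sum I (r : seq I) (F : I -> T -> R[i]) :
  (forall i, inL2 mu (F i)) -> inL2 mu (fun x => \sum_(i <- r) F i x).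
Proof.
move=> iF; elim: r => [|i r IH].
  by under eq_fun do rewrite big_nil; exact: inL2_0.
by under eq_fun do rewrite big_cons; exact: inL2D.
Qed.

(** The product is dominated by |f|^2 + |g|^2. *)
Lemma cintegrableM f g : inL2 mu f -> inL2 mu g ->
  cintegrable setT (fun x => f x * g x).
Proof.
move=> [mf f2] [mg g2].
have [m1 m2] := cmeasurableM mf mg.
pose G x := ((Normc.normc (f x) ^+ 2)%:E + (Normc.normc (g x) ^+ 2)%:E)%E.
have iG : mu.-integrable setT G.
  apply: integrableD => //; apply/integrableP; split.
  - exact: measurable_normc_sqE.
  - by under eq_integral do rewrite gee0_abs ?lee_fin ?sqr_ge0//.
  - exact: measurable_normc_sqE.
  - by under eq_integral do rewrite gee0_abs ?lee_fin ?sqr_ge0//.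
split; apply: (le_integrable measurableT _ _ iG); try exact/measurable_EFinP.
- move=> x _; rewrite /G -EFinD !abse_EFin lee_fin.
  rewrite [leRHS]ger0_norm ?addr_ge0 ?sqr_ge0//.
  rewrite ReM !normc_sq; exact: norm_det_le.
- move=> x _; rewrite /G -EFinD !abse_EFin lee_fin.
  rewrite [leRHS]ger0_norm ?addr_ge0 ?sqr_ge0//.
  rewrite ImM !normc_sq -[X in _ + X]opprK -mulNr.
  have := norm_det_le (complex.Re (f x)) (- complex.Im (f x))
    (complex.Im (g x)) (complex.Re (g x)).
  by rewrite sqrrN (addrC (_ (g x) ^+ 2)).
Qed.

End ComplexIntegral.

(** * Invariance of the Lebesgue measure *)

Section LebesgueInvariance.
Context (R : realType).
Local Notation mu := (@lebesgue_measure R).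
Local Notation measR := (measurableTypeR R).

Lemma lebesgue_measure_translate (a : R) (A : set measR) : measurable A ->
  pushforward mu ((fun x => x + a) : measR -> measR) A = mu A.
Proof.
have mphi : measurable_fun setT ((fun x => x + a) : measR -> measR).
  by apply: measurable_funD => //; exact: measurable_cst.
move=> mA; apply/esym/lebesgue_measure_unique => //= _ [[u v]] _ <-.
rewrite /pushforward (_ : _ @^-1` _ = `]u - a, v - a]%classic).
  rewrite !lebesgue_measure_itv/= !lte_fin ltrD2r.
  by case: ifPn => // _; rewrite -!EFinD; congr (_%:E); ring.
by apply/seteqP; split => x /=; rewrite !in_itv/= ltrBlDr lerBrDr.
Qed.

Lemma ge0_integral_translate (f : R -> \bar R) (a : R) :
  measurable_fun setT f -> (forall x, 0 <= f x)%E ->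
  (\int[mu]_x f (x + a)%R = \int[mu]_x f x)%E.
Proof.
move=> mf f0.
have mphi : measurable_fun setT ((fun x => x + a) : measR -> measR).
  by apply: measurable_funD => //; exact: measurable_cst.
rewrite -[LHS](@ge0_integral_pushforward _ _ _ _ _ _ mphi mu setT)//.
by apply: eq_measure_integral => //= A mA _; exact: lebesgue_measure_translate.
Qed.

Lemma ge0_integral_opp (f : R -> \bar R) :
  measurable_fun setT f -> (forall x, 0 <= f x)%E ->
  (\int[mu]_x f (- x)%R = \int[mu]_x f x)%E.
Proof.
move=> mf f0.
have mphi : measurable_fun setT (-%R : measR -> measR) by exact: oppr_measurable.
rewrite -[LHS](@ge0_integral_pushforward _ _ _ _ _ _ mphi mu setT)//.
by apply: eq_measure_integral => //= A mA _; exact: lebesgue_measureN.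
Qed.

Lemma ge0_integral_reflect (f : R -> \bar R) (a : R) :
  measurable_fun setT f -> (forall x, 0 <= f x)%E ->
  (\int[mu]_x f (a - x)%R = \int[mu]_x f x)%E.
Proof.
move=> mf f0; rewrite -(ge0_integral_translate a mf f0).
have mfa : measurable_fun setT (fun x : R => f (x + a)).
  apply: measurableT_comp => //.
  by apply: measurable_funD => //; exact: measurable_cst.
rewrite -[RHS]ge0_integral_opp//.
by apply: eq_integral => x _; rewrite addrC.
Qed.

(** The nonnegative case, applied to the positive and to the negative part. *)
Lemma integral_translate (f : R -> \bar R) (a : R) : measurable_fun setT f ->
  (\int[mu]_x f (x + a)%R = \int[mu]_x f x)%E.
Proof.
move=> mf; rewrite integralE [RHS]integralE.
congr (_ - _)%E.
  rewrite -(ge0_integral_translate a (measurable_funepos mf) (funepos_ge0 f)).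
  by apply: eq_integral => x _; rewrite funepos_comp.
rewrite -(ge0_integral_translate a (measurable_funeneg mf) (funeneg_ge0 f)).
by apply: eq_integral => x _; rewrite funeneg_comp.
Qed.

Lemma integral_reflect (f : R -> \bar R) (a : R) : measurable_fun setT f ->
  (\int[mu]_x f (a - x)%R = \int[mu]_x f x)%E.
Proof.
move=> mf; rewrite integralE [RHS]integralE.
congr (_ - _)%E.
  rewrite -(ge0_integral_reflect a (measurable_funepos mf) (funepos_ge0 f)).
  by apply: eq_integral => x _; rewrite funepos_comp.
rewrite -(ge0_integral_reflect a (measurable_funeneg mf) (funeneg_ge0 f)).
by apply: eq_integral => x _; rewrite funeneg_comp.
Qed.

Lemma Rintegral_translate (f : R -> R) (a : R) : measurable_fun setT f ->
  \int[mu]_x f (x + a) = \int[mu]_x f x.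
Proof.
move=> mf; rewrite /Rintegral; congr fine.
by rewrite (integral_translate (f := EFin \o f))//; exact/measurable_EFinP.
Qed.

Lemma Rintegral_reflect (f : R -> R) (a : R) : measurable_fun setT f ->
  \int[mu]_x f (a - x) = \int[mu]_x f x.
Proof.
move=> mf; rewrite /Rintegral; congr fine.
by rewrite (integral_reflect (f := EFin \o f))//; exact/measurable_EFinP.
Qed.

Lemma integrable_translate (f : R -> R) (a : R) :
  mu.-integrable setT (EFin \o f) ->
  mu.-integrable setT (fun x => (f (x + a))%:E).
Proof.
move=> /integrableP[mf fi]; apply/integrableP; split.
  apply: (measurableT_comp mf).
  by apply: measurable_funD => //; exact: measurable_cst.
rewrite (ge0_integral_translate (f := abse \o (EFin \o f))) => //.
  exact: measurableT_comp.
by move=> x; exact: abse_ge0.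
Qed.

Lemma integrable_reflect (f : R -> R) (a : R) :
  mu.-integrable setT (EFin \o f) ->
  mu.-integrable setT (fun x => (f (a - x))%:E).
Proof.
move=> /integrableP[mf fi]; apply/integrableP; split.
  apply: (measurableT_comp mf).
  by apply: measurable_funB => //; exact: measurable_cst.
rewrite (ge0_integral_reflect (f := abse \o (EFin \o f))) => //.
  exact: measurableT_comp.
by move=> x; exact: abse_ge0.
Qed.

Lemma cintegral_translate (f : R -> R[i]) (a : R) : cmeasurable f ->
  cintegral mu setT (fun t => f (t + a)) = cintegral mu setT f.
Proof.
move=> [f1 f2]; apply: complex_eq; rewrite /cintegral /=.
  exact: (Rintegral_translate (f := fun t => complex.Re (f t))).
exact: (Rintegral_translate (f := fun t => complex.Im (f t))).
Qed.

Lemma inL2_translate (f : R -> R[i]) (a : R) : inL2 mu f ->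
  inL2 mu (fun t => f (t + a)).
Proof.
move=> [mf f2].
have ma : measurable_fun setT (fun t : R => t + a).
  by apply: measurable_funD => //; exact: measurable_cst.
split; first exact: cmeasurable_comp mf ma.
rewrite /L2normsq.
rewrite (ge0_integral_translate (f := fun t => (Normc.normc (f t) ^+ 2)%:E)) => //.
  exact: measurable_normc_sqE.
by move=> x; rewrite lee_fin sqr_ge0.
Qed.

End LebesgueInvariance.

(** * The Poisson kernel *)

Section Poisson.
Context (R : realType).
Local Notation mu := (@lebesgue_measure R).

Lemma integralT_even_FTC (f F : R -> R) (l : R) :
  (forall x, 0 <= f x) -> continuous f -> (forall x, f (- x) = f x) ->
  (forall x : R, 0 < x -> is_derive x 1 F (f x)) -> {for 0, continuous F} ->
  F x @[x --> +oo%R] --> l ->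
  (\int[mu]_x (f x)%:E = (2 * (l - F 0))%:E)%E.
Proof.
move=> f0 cf fN dF cF Fl.
rewrite ge0_symfun_integralT//; last by move=> x /=; rewrite fN.
rewrite -set_itvcy (ge0_continuous_FTC2y _ _ Fl)//.
- by apply: continuous_subspaceT.
- by move=> x x0; have [] := dF x x0.
- exact: cvg_at_right_filter.
- move=> x; rewrite in_itv/= andbT => x0; rewrite derive1E.
  by have H := dF x x0; exact: derive_val.
Qed.

(** An even integrable weight with a nonnegative Fourier transform of integral 1,
which damps the spectrum less and less as [e] tends to 0. *)
Definition poisson_weight (e x : R) : R := expR (- (e * `|x|)).

(** The Fourier transform of [poisson_weight e]. *)
Definition poisson_kernel (e u : R) : R :=
  2 * e / (e ^+ 2 + (2 * pi * u) ^+ 2).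

Lemma continuous_poisson_weight e : continuous (poisson_weight e).
Proof.
move=> x; apply: continuous_comp; last exact: continuous_expR.
by apply: cvgN; apply: cvgM; [exact: cvg_cst|exact: norm_continuous].
Qed.

Lemma measurable_poisson_weight e : measurable_fun setT (poisson_weight e).
Proof. apply: continuous_measurable_fun; exact: continuous_poisson_weight. Qed.

Lemma poisson_weight_gt0 e x : 0 < poisson_weight e x.
Proof. exact: expR_gt0. Qed.

Lemma poisson_weightN e x : poisson_weight e (- x) = poisson_weight e x.
Proof. by rewrite /poisson_weight normrN. Qed.

Lemma poisson_weight_le1 e x : 0 < e -> poisson_weight e x <= 1.
Proof.
by move=> e0; rewrite /poisson_weight -expR0 ler_expR oppr_le0 mulr_ge0// ltW.
Qed.

Lemma cvg_expR_decay (e : R) : 0 < e -> expR (- (e * x)) @[x --> +oo%R] --> (0 : R).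
Proof.
move=> e0; apply: (@cvg_comp _ _ _ (fun x => e * x) (fun y => expR (- y)));
  last exact: cvgr_expR.
exact: gt0_cvgMry.
Qed.

Lemma integral_poisson_weight e : 0 < e ->
  (\int[mu]_x (poisson_weight e x)%:E = (2 / e)%:E)%E.
Proof.
move=> e0; pose F x : R := - (e^-1 * expR (- (e * x))).
have -> : (2 / e)%:E = (2 * (0 - F 0))%:E.
  by rewrite /F mulr0 oppr0 expR0 mulr1 opprK add0r.
apply: integralT_even_FTC.
- by move=> x; exact/ltW/poisson_weight_gt0.
- exact: continuous_poisson_weight.
- exact: poisson_weightN.
- move=> x x0; rewrite /F /poisson_weight gtr0_norm//.
  apply: is_derive_eq; rewrite /GRing.scale/=.
  by field; rewrite gt_eqF.
- apply: differentiable_continuous; apply/derivable1_diffP.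
  by apply: ex_derive.
- rewrite /F -oppr0 -(mulr0 e^-1); apply: cvgN; apply: cvgM; first exact: cvg_cst.
  exact: cvg_expR_decay.
Qed.

Lemma integrable_poisson_weight e : 0 < e ->
  mu.-integrable setT (EFin \o poisson_weight e).
Proof.
move=> e0; apply/integrableP; split.
  by apply/measurable_EFinP; exact: measurable_poisson_weight.
under eq_integral do rewrite /= ger0_norm ?(ltW (poisson_weight_gt0 _ _))//.
by rewrite integral_poisson_weight// ltry.
Qed.

(** The fundamental theorem of calculus on a half-line is applied to the nonnegative
function [w (1 + cos)], and the integral of [w] is subtracted. *)
Lemma Rintegral_poisson_weight_cos e u : 0 < e ->
  \int[mu]_x (poisson_weight e x * cos (2 * pi * (x * u))) = poisson_kernel e u.
Proof.
move=> e0; pose c : R := 2 * pi * u.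
have ccos : continuous (fun x : R => cos (2 * pi * (x * u))).
  move=> x; apply: (continuous_comp (f := fun x : R => 2 * pi * (x * u)));
    last exact: continuous_cos.
  by apply: cvgM; [exact: cvg_cst|apply: cvgM; [exact: cvg_id|exact: cvg_cst]].
have mcos : measurable_fun setT (fun x : R => cos (2 * pi * (x * u))).
  exact: continuous_measurable_fun.
have icos : mu.-integrable setT
    (EFin \o (fun x => poisson_weight e x * cos (2 * pi * (x * u)))).
  apply: (le_integrable measurableT _ _ (integrable_poisson_weight e0)).
    apply/measurable_EFinP; apply: measurable_funM => //.
    exact: measurable_poisson_weight.
  move=> x _ /=; rewrite lee_fin normrM ler_piMr// ler_norml.
  by rewrite cos_geN1 cos_le1.
pose f x : R := poisson_weight e x * (1 + cos (2 * pi * (x * u))).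
have k0 : e ^+ 2 + c ^+ 2 != 0.
  by rewrite gt_eqF// ltr_pwDl ?sqr_ge0// exprn_gt0.
have fE : (\int[mu]_x (f x)%:E = (2 / e + poisson_kernel e u)%:E)%E.
  pose F x : R := expR (- (e * x)) *
    ((- e * cos (c * x) + c * sin (c * x)) / (e ^+ 2 + c ^+ 2) - e^-1).
  have -> : (2 / e + poisson_kernel e u)%:E = (2 * (0 - F 0))%:E.
    rewrite /F /poisson_kernel -/c mulr0 oppr0 expR0 mulr0 cos0 sin0.
    by congr (_%:E); field; rewrite k0 gt_eqF.
  apply: integralT_even_FTC.
  - move=> x; apply: mulr_ge0; first exact/ltW/poisson_weight_gt0.
    by rewrite -[leLHS](subrr 1) lerD2l cos_geN1.
  - move=> x; apply: cvgM; first exact: continuous_poisson_weight.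
    by apply: cvgD; [exact: cvg_cst|exact: ccos].
  - by move=> x; rewrite /f poisson_weightN mulNr mulrN cosN.
  - move=> x x0; rewrite /F /f /poisson_weight gtr0_norm//.
    rewrite (_ : 2 * pi * (x * u) = c * x); last by rewrite /c; ring.
    apply: is_derive_eq; rewrite /GRing.scale/=.
    by field; rewrite k0 gt_eqF.
  - apply: differentiable_continuous; apply/derivable1_diffP.
    by apply: ex_derive.
  - pose K : R := (e + `|c|) / (e ^+ 2 + c ^+ 2) + e^-1.
    have K0 : 0 < e ^+ 2 + c ^+ 2 by rewrite lt0r k0 addr_ge0 ?sqr_ge0.
    apply: (@squeeze_cvgr _ _ _ _ (fun x => - (K * expR (- (e * x))))
        (fun x => K * expR (- (e * x)))).
    + apply: nearW => x; rewrite -ler_norml /F normrM mulrC.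
      rewrite (ger0_norm (expR_ge0 _)) ler_wpM2r ?expR_ge0//.
      apply: (le_trans (ler_normB _ _)); rewrite normrM !normfV.
      rewrite (gtr0_norm K0) (gtr0_norm e0) lerD2r ler_wpM2r ?invr_ge0 ?(ltW K0)//.
      apply: (le_trans (ler_normD _ _)); rewrite !normrM normrN (gtr0_norm e0).
      by apply: lerD; rewrite ler_piMr ?(ltW e0)// ler_norml
        ?cos_geN1 ?cos_le1 ?sin_geN1 ?sin_le1.
    + rewrite -oppr0 -(mulr0 K); apply: cvgN; apply: cvgM; first exact: cvg_cst.
      exact: cvg_expR_decay.
    + rewrite -[X in _ --> X](mulr0 K); apply: cvgM; first exact: cvg_cst.
      exact: cvg_expR_decay.
have : \int[mu]_x f x = 2 / e + poisson_kernel e u by rewrite /Rintegral fE.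
rewrite /f; under eq_Rintegral do rewrite mulrDr mulr1.
rewrite RintegralD//; last exact: integrable_poisson_weight.
by rewrite {1}/Rintegral integral_poisson_weight//= => /addrI.
Qed.

Lemma poisson_kernel_ge0 e u : 0 < e -> 0 <= poisson_kernel e u.
Proof.
by move=> e0; rewrite divr_ge0 ?addr_ge0 ?sqr_ge0// mulr_ge0// ltW.
Qed.

Lemma continuous_poisson_kernel e : 0 < e -> continuous (poisson_kernel e).
Proof.
move=> e0 x; apply: cvgM; first exact: cvg_cst.
apply: cvgV.
  by rewrite gt_eqF// ltr_pwDl ?sqr_ge0// exprn_gt0.
apply: cvgD; first exact: cvg_cst.
by rewrite expr2; apply: cvgM; (apply: cvgM; [exact: cvg_cst|exact: cvg_id]).
Qed.

(** The primitive is an arctangent. *)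
Lemma integral_poisson_kernel e : 0 < e ->
  (\int[mu]_u (poisson_kernel e u)%:E = 1)%E.
Proof.
move=> e0; have pi0 := pi_gt0 R; pose F x : R := atan (2 * pi / e * x) / pi.
have -> : 1%E = (2 * ((pi / 2) / pi - F 0))%:E :> \bar R.
  rewrite /F mulr0 atan0 mul0r; congr (_%:E).
  by move: (pi : R) pi0 => p p0; field; rewrite gt_eqF.
apply: integralT_even_FTC.
- by move=> x; exact: poisson_kernel_ge0.
- exact: continuous_poisson_kernel.
- by move=> x; rewrite /poisson_kernel mulrN sqrrN.
- move=> x x0; rewrite /F /poisson_kernel.
  have k0 : e ^+ 2 + (2 * pi * x) ^+ 2 != 0.
    by rewrite gt_eqF// ltr_pwDl ?sqr_ge0// exprn_gt0.
  apply: is_derive_eq; rewrite /GRing.scale/=.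
  move: (pi : R) pi0 k0 => p p0 k0.
  have -> : 1 + (2 * p / e * x) ^+ 2 = (e ^+ 2 + (2 * p * x) ^+ 2) / e ^+ 2.
    by field; rewrite gt_eqF.
  by rewrite invf_div; field; rewrite k0 !gt_eqF.
- apply: differentiable_continuous; apply/derivable1_diffP.
  by apply: ex_derive.
- apply: cvgM; last exact: cvg_cst.
  apply: (@cvg_comp _ _ _ (fun x => 2 * pi / e * x) (@atan R)); last exact: cvgy_atan.
  by apply: gt0_cvgMry => //; rewrite divr_gt0// mulr_gt0.
Qed.

End Poisson.

(** * Continuity of translations in L2 *)

Section TranslationContinuity.
Context (R : realType).
Local Notation mu := (@lebesgue_measure R).

Lemma continuous_bounded_itv (g : R -> R) (n : R) : continuous g ->
  exists2 C, 0 <= C & forall x, `|x| <= n -> `|g x| <= C.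
Proof.
move=> cg; have cpt : compact (g @` `[- n, n]).
  by apply: continuous_compact; [exact: continuous_subspaceT|exact: segment_compact].
have [M [Mreal hM]] := compact_bounded cpt.
exists (`|M| + 1); first by rewrite addr_ge0.
move=> x xn; apply: (hM (`|M| + 1)); first by rewrite ltr_pwDr// ler_norm.
by exists x => //=; rewrite in_itv/= -ler_norml.
Qed.

Lemma itvN_norm (n x : R) : [set` `[(- n)%R, n]%R] x = (`|x| <= n) :> Prop.
Proof. by rewrite /= in_itv/= -ler_norml. Qed.

Lemma lebesgue_measure_itvN_lty (n : R) : (mu `[(- n)%R, n%R]%classic < +oo)%E.
Proof.
by rewrite lebesgue_measure_itv/=; case: ifPn => // _; rewrite -EFinB ltry.
Qed.

(** Dominated convergence, [g] being bounded on a neighbourhood of the interval. *)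
Lemma continuous_translate_near (g : R -> R) (n d : R) : continuous g -> 0 < d ->
  exists2 r, 0 < r & forall u, `|u| < r ->
    (\int[mu]_(x in `[(- n)%R, n%R]) (`|g x - g (x - u)|)%:E <= d%:E)%E.
Proof.
move=> cg d0; pose F u := \int[mu]_(x in `[- n, n]) `|g x - g (x - u)|.
have [C C0 gC] := continuous_bounded_itv (n + 1) cg.
have cf1 u : continuous (fun x => `|g x - g (x - u)|).
  move=> x; apply: cvg_norm; apply: cvgB; first exact: cg.
  apply: (continuous_comp (f := fun x : R => x - u)); last exact: cg.
  by apply: cvgB; [exact: cvg_id|exact: cvg_cst].
have itvle (x : R) : [set` `[(- n)%R, n]%R] x -> `|x| <= n by rewrite itvN_norm.
have bnd (u x : R) : [set` `](-1)%R, 1%R[%R] u -> [set` `[(- n)%R, n]%R] x ->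
    `|g x - g (x - u)| <= C + C.
  rewrite /= in_itv/= -ltr_norml => u1 /itvle xn.
  rewrite (le_trans (ler_normB _ _))// lerD// gC//.
    by rewrite (le_trans xn)// lerDl.
  by rewrite (le_trans (ler_normB _ _))// lerD// ltW.
have icst : mu.-integrable `[- n, n] (EFin \o (fun=> C + C)).
  apply: measurable_bounded_integrable => //; first exact: lebesgue_measure_itvN_lty.
  by exists (C + C); split => [|y yC z _]; [rewrite num_real|
    rewrite /= ger0_norm ?addr_ge0// ltW].
have ig (u : R) : [set` `](-1)%R, 1%R[%R] u ->
    mu.-integrable `[- n, n] (EFin \o (fun x => `|g x - g (x - u)|)).
  move=> u1; apply: le_integrable icst => //.
    by apply/measurable_EFinP; apply: measurable_funTS; apply: continuous_measurable_fun.
  move=> x xn /=; rewrite lee_fin normr_id (ger0_norm (addr_ge0 C0 C0)).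
  exact: bnd.
have cF : {for 0, continuous F}.
  apply: (@continuity_under_integral R _ _ mu (fun u x => `|g x - g (x - u)|)
    _ _ (-1) 1 ig _ _ icst) => //; last first.
  - by rewrite inE/= in_itv/= ltrN10 ltr01.
  - move=> u u1; apply: aeW => x xn; rewrite /= normr_id; exact: bnd.
  - apply: aeW => x _ u _; apply: cvg_norm; apply: cvgB; first exact: cvg_cst.
    apply: (continuous_comp (f := fun u : R => x - u)); last exact: cg.
    by apply: cvgB; [exact: cvg_cst|exact: cvg_id].
have F0 : F 0 = 0.
  rewrite /F; under eq_Rintegral do rewrite subr0 subrr normr0.
  by rewrite Rintegral_cst// mul0r.
move/cvgrPdist_lt : (cF) => /(_ d d0); rewrite F0 => -[r /= r0 hr].
exists (Num.min r 1); first by rewrite lt_min r0/=.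
move=> u; rewrite lt_min => /andP[ur u1].
have /hr : ball_ Num.norm 0 r u by rewrite /ball_/= sub0r normrN.
have {}u1 : [set` `](-1)%R, 1%R[%R] u by rewrite /= in_itv/= -ltr_norml.
rewrite /= sub0r normrN => Fd.
have : (\int[mu]_(x in `[(- n)%R, n%R]) (`|g x - g (x - u)|)%:E \is a fin_num)%E.
  by apply: integrable_fin_num => //; exact: ig.
move=> /fineK => <-; rewrite lee_fin; apply: ltW; apply: le_lt_trans Fd.
exact: ler_norm.
Qed.

Lemma measurable_translate (q : R -> R) (u : R) : measurable_fun setT q ->
  measurable_fun setT (fun x : R => q (x - u)).
Proof.
move=> mq; apply: measurableT_comp mq _.
by apply: measurable_funB => //; exact: measurable_cst.
Qed.

(** [q] is approximated in L1 on a bounded interval by a continuous [g]. Boundedness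
of [q] turns the L1 estimate into an L2 estimate. *)
Lemma bounded_translate_near (q : R -> R) (M n d : R) : measurable_fun setT q ->
  (forall x, `|q x| <= M) -> (forall x, n < `|x| -> q x = 0) -> 0 < d ->
  exists2 r, 0 < r & forall u, `|u| < r ->
    (\int[mu]_x ((q x - q (x - u)) ^+ 2)%:E <= d%:E)%E.
Proof.
move=> mq qM qn d0.
have M0 : 0 <= M by apply: le_trans (qM 0).
(* The squared increment is at most 2 (M + 1) times the increment, which is split
into three parts of L1 norm at most eta. *)
pose eta := d / (6 * (M + 1)).
have eta0 : 0 < eta by rewrite divr_gt0// mulr_gt0// ltr_wpDl.
pose E : set R := [set` `[- (n + 1), n + 1]].
pose E' : set R := [set` `[- (n + 2), n + 2]].
have mE : measurable E by exact: measurable_itv.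
have mE' : measurable E' by exact: measurable_itv.
have [g [cg gE']] : exists g : R -> R, continuous g /\
    (\int[mu]_(x in E') `|(q x - g x)%:E| < eta%:E)%E.
  have iq : mu.-integrable E' (EFin \o q).
    apply: measurable_bounded_integrable => //.
    - exact: lebesgue_measure_itvN_lty.
    - exact: measurable_funTS.
    - exists M; split => [|y yM z _]; first by rewrite num_real.
      by apply: le_trans (qM z) _; exact: ltW.
  have [g_ [cg ig gq]] := approximation_continuous_integrable
    (measurable_itv _) (lebesgue_measure_itvN_lty _) iq.
  have [N HN] := cvge0_near gq eta0.
  by exists (g_ N); split => //; exact: HN.
have [r r0 hr] := continuous_translate_near (n + 1) cg eta0.
exists (Num.min r 1); first by rewrite lt_min r0/=.
move=> u; rewrite lt_min => /andP[ur u1].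
have mg : measurable_fun setT g by exact: continuous_measurable_fun.
pose k := (fun x => `|(q x - g x)%:E|%E) \_ E'.
pose l := (fun x => (`|g x - g (x - u)|)%:E) \_ E.
have mk : measurable_fun setT k.
  apply/(measurable_restrictT _ _).1 => //; apply: measurable_funTS.
  by apply: measurableT_comp => //; apply/measurable_EFinP; exact: measurable_funB.
have ml : measurable_fun setT l.
  apply/(measurable_restrictT _ _).1 => //; apply: measurable_funTS.
  apply/measurable_EFinP; apply: measurableT_comp => //.
  by apply: measurable_funB => //; exact: measurable_translate.
have k0 x : (0 <= k x)%E by rewrite /k patchE; case: ifP.
have l0 x : (0 <= l x)%E by rewrite /l patchE; case: ifP => // _; rewrite lee_fin.
have mku : measurable_fun setT (fun x : R => k (x - u)).
  apply: measurableT_comp mk _.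
  by apply: measurable_funB => //; exact: measurable_cst.
have le1 x : (((q x - q (x - u)) ^+ 2)%:E <=
    (2 * (M + 1))%:E * (k x + l x + k (x - u)%R))%E.
  have [xn|xn] := leP `|x| (n + 1); last first.
    rewrite (qn x); last by rewrite (lt_trans _ xn)// ltrDl.
    rewrite (qn (x - u)); last first.
      by have := lerB_dist x u; move: xn u1; lra.
    rewrite subrr expr0n; apply: mule_ge0; rewrite ?lee_fin ?mulr_ge0 ?addr_ge0//.
    by rewrite !adde_ge0.
  have xE : x \in E by rewrite inE /E itvN_norm.
  have xE' : x \in E' by rewrite inE /E' itvN_norm (le_trans xn)// lerD2l; lra.
  have xuE' : x - u \in E'.
    rewrite inE /E' itvN_norm (le_trans (ler_normB _ _))//.
    by rewrite (le_trans (lerD xn (ltW u1)))//; lra.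
  rewrite /k /l !patchE xE xE' xuE' /= -!EFinD -EFinM lee_fin.
  rewrite -[leLHS]ger0_norm ?sqr_ge0// normrX expr2 ler_pM//.
    rewrite (le_trans (ler_normB _ _))// (le_trans (lerD (qM _) (qM _)))//; lra.
  rewrite (_ : q x - q (x - u) =
    (q x - g x) + (g x - g (x - u)) - (q (x - u) - g (x - u))); last by ring.
  by rewrite (le_trans (ler_normB _ _))// lerD2r ler_normD.
have kE : (\int[mu]_x k x = \int[mu]_(x in E') `|(q x - g x)%:E|)%E.
  by rewrite /k -integral_mkcond.
have lE : (\int[mu]_x l x <= eta%:E)%E.
  by rewrite /l -integral_mkcond; apply: hr.
apply: (@le_trans _ _ (\int[mu]_x ((2 * (M + 1))%:E * (k x + l x + k (x - u)%R)))%E).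
  apply: ge0_le_integral => //.
  - by move=> x _; rewrite lee_fin sqr_ge0.
  - apply/measurable_EFinP; apply: measurable_funX.
    by apply: measurable_funB => //; exact: measurable_translate.
  - apply: measurable_funeM; apply: emeasurable_funD => //.
    exact: emeasurable_funD.
rewrite ge0_integralZl//; first last.
- by rewrite lee_fin mulr_ge0// addr_ge0.
- by move=> x _; rewrite !adde_ge0.
- by apply: emeasurable_funD => //; exact: emeasurable_funD.
rewrite ge0_integralD//; last 2 first.
- by move=> x _; rewrite adde_ge0.
- exact: emeasurable_funD.
rewrite ge0_integralD// ge0_integral_translate// kE.
have -> : d%:E = ((2 * (M + 1))%:E * (eta%:E + eta%:E + eta%:E))%E.
  rewrite -!EFinD -EFinM /eta; congr (_%:E); field.
  by rewrite gt_eqF// ltr_wpDl.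
apply: lee_wpmul2l; first by rewrite lee_fin mulr_ge0// addr_ge0.
by apply: leeD => //; [apply: leeD => //|]; exact: ltW.
Qed.

End TranslationContinuity.

Section TranslationContinuityL2.
Context (R : realType).
Local Notation mu := (@lebesgue_measure R).

Lemma integral_sqr_sum3_le (a b c : R -> R) : measurable_fun setT a ->
  measurable_fun setT b -> measurable_fun setT c ->
  (\int[mu]_x ((a x + b x + c x) ^+ 2)%:E <=
   3%:E * (\int[mu]_x (a x ^+ 2)%:E + \int[mu]_x (b x ^+ 2)%:E +
           \int[mu]_x (c x ^+ 2)%:E))%E.
Proof.
move=> ma mb mc.
have mE (f : R -> R) : measurable_fun setT f ->
    measurable_fun setT (fun x => (f x ^+ 2)%:E).
  by move=> mf; apply/measurable_EFinP; exact: measurable_funX.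
have ge0 (f : R -> R) x : setT x -> (0 <= (f x ^+ 2)%:E)%E.
  by move=> _; rewrite lee_fin sqr_ge0.
have mab := emeasurable_funD (mE a ma) (mE b mb).
have ab0 x : setT x -> (0 <= (a x ^+ 2)%:E + (b x ^+ 2)%:E)%E.
  by move=> _; rewrite adde_ge0 ?lee_fin ?sqr_ge0.
have e1 : (\int[mu]_x ((a x ^+ 2)%:E + (b x ^+ 2)%:E) =
    \int[mu]_x (a x ^+ 2)%:E + \int[mu]_x (b x ^+ 2)%:E)%E.
  by apply: ge0_integralD => //; [exact: ge0|exact: mE|exact: ge0|exact: mE].
have e2 : (\int[mu]_x ((a x ^+ 2)%:E + (b x ^+ 2)%:E + (c x ^+ 2)%:E) =
    \int[mu]_x ((a x ^+ 2)%:E + (b x ^+ 2)%:E) + \int[mu]_x (c x ^+ 2)%:E)%E.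
  by apply: ge0_integralD => //; [exact: ge0|exact: mE].
rewrite -e1 -e2.
rewrite -ge0_integralZl//; first last.
- by move=> x _; rewrite !adde_ge0 ?lee_fin ?sqr_ge0.
- by apply: emeasurable_funD => //; exact: mE.
apply: ge0_le_integral => //.
- by move=> x _; rewrite lee_fin sqr_ge0.
- by apply: (mE (fun x => a x + b x + c x)); do 2 apply: measurable_funD => //.
- by apply: measurable_funeM; apply: emeasurable_funD => //; exact: mE.
move=> x _; rewrite -!EFinD -EFinM lee_fin -subr_ge0.
rewrite (_ : _ - _ = (a x - b x) ^+ 2 + (a x - c x) ^+ 2 + (b x - c x) ^+ 2);
  last by ring.
by rewrite !addr_ge0 ?sqr_ge0.
Qed.

(** Continuity at 0 of translation in L2: truncating both the values and the
support of [p] costs little in L2, and a bounded function with bounded support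
is close in L1 to a continuous one. *)
Lemma L2_translate_near (p : R -> R) (d : R) : measurable_fun setT p ->
  (\int[mu]_x (p x ^+ 2)%:E < +oo)%E -> 0 < d ->
  exists2 r, 0 < r & forall u, `|u| < r ->
    (\int[mu]_x ((p x - p (x - u)) ^+ 2)%:E <= d%:E)%E.
Proof.
move=> mp p2 d0.
pose S n : set R := [set x | `|x| <= n%:R /\ `|p x| <= n%:R].
have mS n : measurable (S n).
  rewrite (_ : S n = (fun x : R => `|x|) @^-1` [set` `]-oo, n%:R]] `&`
    (fun x : R => `|p x|) @^-1` [set` `]-oo, n%:R]]).
    apply: measurableI; rewrite -[X in measurable X]setTI.
    - by apply: normr_measurable => //; exact: measurable_itv.
    - have : measurable_fun setT (fun x => `|p x|) by exact: measurableT_comp.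
      by apply => //; exact: measurable_itv.
  by apply/seteqP; split => x /=; rewrite /S !in_itv/=.
pose q n x : R := p x * \1_(S n) x.
have mq n : measurable_fun setT (q n).
  by apply: measurable_funM => //; exact: measurable_indic.
have qin n x : S n x -> q n x = p x.
  by move=> Sx; rewrite /q indicE mem_set// mulr1.
have qout n x : ~ S n x -> q n x = 0.
  by move=> Sx; rewrite /q indicE memNset// mulr0.
have mpq n : measurable_fun setT (fun x => p x - q n x).
  exact: measurable_funB mp (mq n).
have mpq2 n : measurable_fun setT (fun x => ((p x - q n x) ^+ 2)%:E).
  by apply/measurable_EFinP; exact: measurable_funX (mpq n).
have [_ _ pq] : [/\ mu.-integrable setT (cst 0%E : R -> \bar R),
    [sequence (\int[mu]_x `|((p x - q n x) ^+ 2)%:E - 0|)%E]_n @ \oo --> 0%E &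
    [sequence (\int[mu]_x ((p x - q n x) ^+ 2)%:E)%E]_n @ \oo -->
      (\int[mu]_x (cst 0%E : R -> \bar R) x)%E].
  apply: (@dominated_convergence _ _ _ mu setT measurableT
      (fun n x => ((p x - q n x) ^+ 2)%:E) (cst 0%E) (fun x => (p x ^+ 2)%:E)).
  - exact: mpq2.
  - exact: measurable_cst.
  - apply: aeW => x _; pose N := (Num.truncn (Num.max `|x| `|p x|)).+1.
    apply: cvg_near_cst; exists N => // n /= Nn.
    rewrite qin ?subrr ?expr0n//.
    have h : Num.max `|x| `|p x| <= n%:R.
      rewrite (le_trans (ltW (truncnS_gt _)))// ler_nat//.
    by split; apply: le_trans h; rewrite le_max lexx ?orbT.
  - apply/integrableP; split.
      by apply/measurable_EFinP; exact: measurable_funX.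
    by under eq_integral do rewrite gee0_abs ?lee_fin ?sqr_ge0//.
  - apply: aeW => x n _; rewrite gee0_abs ?lee_fin ?sqr_ge0//.
    have [Sx|Sx] := pselect (S n x).
      by rewrite qin// subrr expr0n sqr_ge0.
    by rewrite qout// subr0.
(* Each of the three parts of the increment is allowed d / 9, as the square of a
sum of three terms is at most 3 times the sum of their squares. *)
have {pq}[N pqN] : exists N, (\int[mu]_x ((p x - q N x) ^+ 2)%:E <= (d / 9)%:E)%E.
  have d9 : 0 < d / 9 by rewrite divr_gt0.
  rewrite integral0 in pq; have [N HN] := cvge0_near pq d9.
  by exists N; apply: ltW; exact: HN.
have d9 : 0 < d / 9 by rewrite divr_gt0.
have [r r0 hr] : exists2 r, 0 < r & forall u, `|u| < r ->
    (\int[mu]_x ((q N x - q N (x - u)) ^+ 2)%:E <= (d / 9)%:E)%E.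
  apply: (bounded_translate_near (q := q N) (M := N%:R) (n := N%:R)
    (mq N) _ _ d9) => x.
    have [Sx|Sx] := pselect (S N x); first by rewrite qin//; case: Sx.
    by rewrite qout// normr0.
  by move=> xN; rewrite qout// /S => -[]; rewrite leNgt xN.
exists r => // u ur.
have mqu : measurable_fun setT (fun x => q N x - q N (x - u)).
  by apply: measurable_funB => //; exact: measurable_translate.
have mqp : measurable_fun setT (fun x : R => q N (x - u) - p (x - u)).
  by apply: measurable_funB; exact: measurable_translate.
have := integral_sqr_sum3_le (mpq N) mqu mqp.
have pE x : p x - q N x + (q N x - q N (x - u)) + (q N (x - u) - p (x - u)) =
    p x - p (x - u) by ring.
under eq_integral do rewrite pE.
move=> /le_trans; apply.
have -> : d%:E = (3%:E * ((d / 9)%:E + (d / 9)%:E + (d / 9)%:E))%E.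
  by rewrite -!EFinD -EFinM; congr (_%:E); lra.
apply: lee_wpmul2l => //; apply: leeD; first by apply: leeD => //; exact: hr.
rewrite (ge0_integral_translate (f := fun x => ((q N x - p x) ^+ 2)%:E)).
- by under eq_integral do rewrite -sqrrN opprB.
- by apply/measurable_EFinP; apply: measurable_funX; exact: measurable_funB.
- by move=> x; rewrite lee_fin sqr_ge0.
Qed.

End TranslationContinuityL2.

(** * Fubini's theorem for real-valued integrals *)

Section FubiniReal.
Context d1 d2 (T1 : measurableType d1) (T2 : measurableType d2) (R : realType).
Variable m1 : {sigma_finite_measure set T1 -> \bar R}.
Variable m2 : {sigma_finite_measure set T2 -> \bar R}.
Variable f : T1 * T2 -> R.
Hypothesis fi : (m1 \x m2)%E.-integrable setT (EFin \o f).

Lemma integrable_Rintegral1 :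
  m1.-integrable setT (fun x => (\int[m2]_y f (x, y))%:E) /\
  (\int[m1]_x (\int[m2]_y f (x, y))%:E =
   \int[(m1 \x m2)%E]_z (f z)%:E)%E.
Proof.
have Fi : m1.-integrable setT (fun x => \int[m2]_y (f (x, y))%:E)%E.
  exact: integrable_fubini_F fi.
have mF := measurable_int _ Fi.
have mF' : measurable_fun setT (fun x => (\int[m2]_y f (x, y))%:E).
  by apply/measurable_EFinP; apply: (measurableT_comp _ mF); exact: fine_measurable.
have FE : ae_eq m1 setT (fun x => (\int[m2]_y f (x, y))%:E)
    (fun x => \int[m2]_y (f (x, y))%:E)%E.
  have := ae_integrable1 fi; apply: filterS => x fxi _ /=.
  rewrite fineK//; exact: integrable_fin_num.
split.
  apply/integrableP; split => //.
  have /integrableP[_] := Fi; congr (_ < _)%E; apply: ae_eq_integral => //.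
  - exact: measurableT_comp.
  - exact: measurableT_comp.
  - by apply: filterS FE => x + _ => /(_ I) ->.
by rewrite -(integral12_prod_meas1 fi); exact: ae_eq_integral.
Qed.

End FubiniReal.

Section FubiniRealSwap.
Context d1 d2 (T1 : measurableType d1) (T2 : measurableType d2) (R : realType).
Variable m1 : {sigma_finite_measure set T1 -> \bar R}.
Variable m2 : {sigma_finite_measure set T2 -> \bar R}.
Variable f : T1 * T2 -> R.
Hypothesis fi : (m1 \x m2)%E.-integrable setT (EFin \o f).

Lemma integrable_Rintegral2 :
  m2.-integrable setT (fun y => (\int[m1]_x f (x, y))%:E) /\
  (\int[m2]_y (\int[m1]_x f (x, y))%:E =
   \int[(m1 \x m2)%E]_z (f z)%:E)%E.
Proof.
have Fi : m2.-integrable setT (fun y => \int[m1]_x (f (x, y))%:E)%E.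
  have mf := measurable_int _ fi.
  apply/integrableP; split; first exact: (measurable_fubini_G fi).
  apply: le_lt_trans ((integrable21ltyP _ _ mf).1 fi).
  have mabs : measurable_fun setT (fun z => `|(f z)%:E|%E).
    exact: measurableT_comp.
  apply: ge0_le_integral => //.
  - by apply: measurableT_comp => //; exact: (measurable_fubini_G fi).
  - exact: (measurable_fun_fubini_tonelli_G _ mabs).
  - move=> y _; apply: le_abse_integral => //.
    exact: (measurableT_comp mf).
have mF := measurable_int _ Fi.
have mF' : measurable_fun setT (fun y => (\int[m1]_x f (x, y))%:E).
  by apply/measurable_EFinP; apply: (measurableT_comp _ mF); exact: fine_measurable.
have FE : ae_eq m2 setT (fun y => (\int[m1]_x f (x, y))%:E)
    (fun y => \int[m1]_x (f (x, y))%:E)%E.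
  have := ae_integrable2 fi; apply: filterS => x fxi _ /=.
  rewrite fineK//; exact: integrable_fin_num.
split.
  apply/integrableP; split => //.
  have /integrableP[_] := Fi; congr (_ < _)%E; apply: ae_eq_integral => //.
  - exact: measurableT_comp.
  - exact: measurableT_comp.
  - by apply: filterS FE => x + _ => /(_ I) ->.
by rewrite -(integral21_prod_meas1 fi); exact: ae_eq_integral.
Qed.

Lemma Rfubini :
  \int[m1]_x \int[m2]_y f (x, y) = \int[m2]_y \int[m1]_x f (x, y).
Proof.
rewrite /Rintegral; congr fine.
by rewrite (integrable_Rintegral1 fi).2 integrable_Rintegral2.2.
Qed.

End FubiniRealSwap.

(** * The Plancherel inequality *)

Section PlaneIntegrability.
Context (R : realType).
Local Notation mu := (@lebesgue_measure R).
Local Notation mu2 := (mu \x mu)%E.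

Lemma integrable_tensor (a b : R -> R) (c : R * R -> R) :
  mu.-integrable setT (EFin \o a) -> mu.-integrable setT (EFin \o b) ->
  measurable_fun setT c -> (forall z, `|c z| <= 1) ->
  mu2.-integrable setT (EFin \o (fun z => a z.1 * b z.2 * c z)).
Proof.
move=> ia ib mc c1.
have ma : measurable_fun setT a by apply/measurable_EFinP; exact: measurable_int ia.
have mb : measurable_fun setT b by apply/measurable_EFinP; exact: measurable_int ib.
have mf : measurable_fun setT (fun z : R * R => a z.1 * b z.2 * c z).
  apply: measurable_funM => //; apply: measurable_funM.
    exact: measurableT_comp ma measurable_fst.
  exact: measurableT_comp mb measurable_snd.
have mf' : measurable_fun setT (EFin \o (fun z : R * R => a z.1 * b z.2 * c z)).
  exact/measurable_EFinP.
apply/integrable12ltyP => //.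
have /integrableP[mae La] := ia; have /integrableP[mbe Lb] := ib.
have mab : measurable_fun setT (fun x : R => `|(a x)%:E|%E).
  exact: (measurableT_comp _ mae).
have mbb : measurable_fun setT (fun x : R => `|(b x)%:E|%E).
  exact: (measurableT_comp _ mbe).
apply: (@le_lt_trans _ _ (\int[mu]_x (`|(a x)%:E| * \int[mu]_y `|(b y)%:E|))%E).
  apply: ge0_le_integral => //.
  - by move=> x _; exact: integral_ge0.
  - have mabs : measurable_fun setT
        (fun z : R * R => `|(a z.1 * b z.2 * c z)%R%:E|%E).
      exact: measurableT_comp.
    exact: (@measurable_fun_fubini_tonelli_F _ _ _ _ R mu _ mabs).
  - by apply: emeasurable_funM => //; exact: measurable_cst.
  - move=> x _; rewrite -ge0_integralZl//.
    apply: ge0_le_integral => //.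
    + apply: measurableT_comp => //.
      exact: (measurableT_comp mf' (pair1_measurable x)).
    + exact: measurable_funeM.
    + by move=> y _; rewrite /= lee_fin !normrM ler_piMr// mulr_ge0.
rewrite ge0_integralZr//; last exact: integral_ge0.
have I0 (h : R -> R) : (0 <= \int[mu]_x `|(h x)%:E|)%E by exact: integral_ge0.
by rewrite lte_mul_pinfty// ge0_fin_numE.
Qed.

Lemma integrable_autocorrelation (p c : R -> R) :
  mu.-integrable setT (EFin \o p) ->
  measurable_fun setT c -> (forall z, `|c z| <= 1) ->
  mu2.-integrable setT (EFin \o (fun z => p z.1 * p (z.1 - z.2) * c z.2)).
Proof.
move=> ip mc c1.
have mp : measurable_fun setT p by apply/measurable_EFinP; exact: measurable_int ip.
have mf : measurable_fun setT (fun z : R * R => p z.1 * p (z.1 - z.2) * c z.2).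
  apply: measurable_funM; last exact: measurableT_comp mc measurable_snd.
  apply: measurable_funM; first exact: measurableT_comp mp measurable_fst.
  apply: (measurableT_comp mp).
  by apply: measurable_funB; [exact: measurable_fst|exact: measurable_snd].
have mf' : measurable_fun setT
    (EFin \o (fun z : R * R => p z.1 * p (z.1 - z.2) * c z.2)).
  exact/measurable_EFinP.
apply/integrable12ltyP => //.
have /integrableP[mpe Lp] := ip.
have mpb : measurable_fun setT (fun x : R => `|(p x)%:E|%E).
  exact: (measurableT_comp _ mpe).
apply: (@le_lt_trans _ _ (\int[mu]_x (`|(p x)%:E| * \int[mu]_y `|(p y)%:E|))%E).
  apply: ge0_le_integral => //.
  - by move=> x _; exact: integral_ge0.
  - have mabs : measurable_fun setT (fun z : R * R =>
        `|(p z.1 * p (z.1 - z.2) * c z.2)%R%:E|%E).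
      exact: measurableT_comp.
    exact: (@measurable_fun_fubini_tonelli_F _ _ _ _ R mu _ mabs).
  - by apply: emeasurable_funM => //; exact: measurable_cst.
  - move=> x _; rewrite -(ge0_integral_reflect x mpb)//.
    have mpx : measurable_fun setT (fun y : R => `|(p (x - y))%:E|%E).
      apply: (measurableT_comp mpb).
      by apply: measurable_funB => //; exact: measurable_cst.
    rewrite -ge0_integralZl//.
    apply: ge0_le_integral => //.
    + apply: measurableT_comp => //.
      exact: (measurableT_comp mf' (pair1_measurable x)).
    + exact: measurable_funeM.
    + by move=> y _; rewrite /= lee_fin !normrM ler_piMr// mulr_ge0.
rewrite ge0_integralZr//; last exact: integral_ge0.
have I0 (h : R -> R) : (0 <= \int[mu]_x `|(h x)%:E|)%E by exact: integral_ge0.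
by rewrite lte_mul_pinfty// ge0_fin_numE.
Qed.

End PlaneIntegrability.

Section RealPlancherel.
Context (R : realType).
Local Notation mu := (@lebesgue_measure R).
Local Notation mu2 := (mu \x mu)%E.

Lemma integrable_mul_sq d (T : measurableType d) (m : {measure set T -> \bar R})
    (a b : T -> R) : measurable_fun setT a -> measurable_fun setT b ->
  m.-integrable setT (fun x => (a x ^+ 2)%:E) ->
  m.-integrable setT (fun x => (b x ^+ 2)%:E) ->
  m.-integrable setT (fun x => (a x * b x)%:E).
Proof.
move=> ma mb ia ib.
apply: (le_integrable measurableT _ _ (integrableD measurableT ia ib)).
  by apply/measurable_EFinP; exact: measurable_funM.
move=> x _ /=; rewrite lee_fin [leRHS]ger0_norm ?addr_ge0 ?sqr_ge0//.
exact: normM_le_sq.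
Qed.

Lemma measurable_cos_bilin (nu : R) :
  measurable_fun setT (fun t : R => cos (2 * pi * (nu * t))).
Proof.
apply: (measurableT_comp (f := @cos R)).
  by apply: continuous_measurable_fun; exact: continuous_cos.
by apply: measurable_funM => //; apply: measurable_funM.
Qed.

Lemma measurable_sin_bilin (nu : R) :
  measurable_fun setT (fun t : R => sin (2 * pi * (nu * t))).
Proof.
apply: (measurableT_comp (f := @sin R)).
  by apply: continuous_measurable_fun; exact: continuous_sin.
by apply: measurable_funM => //; apply: measurable_funM.
Qed.

Lemma norm_cos_le1 (x : R) : `|cos x| <= 1.
Proof. by rewrite ler_norml cos_geN1 cos_le1. Qed.

Lemma norm_sin_le1 (x : R) : `|sin x| <= 1.
Proof. by rewrite ler_norml sin_geN1 sin_le1. Qed.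

Lemma integrableM_le1 (p c : R -> R) :
  mu.-integrable setT (EFin \o p) -> measurable_fun setT c ->
  (forall x, `|c x| <= 1) -> mu.-integrable setT (fun x => (p x * c x)%:E).
Proof.
move=> ip mc c1.
have mp : measurable_fun setT p by apply/measurable_EFinP; exact: measurable_int ip.
apply: (le_integrable measurableT _ _ ip).
  by apply/measurable_EFinP; exact: measurable_funM.
by move=> x _ /=; rewrite lee_fin normrM ler_piMr.
Qed.

Section Real.
Variable p : R -> R.
Hypothesis ip : mu.-integrable setT (EFin \o p).
Hypothesis p2 : (\int[mu]_x (p x ^+ 2)%:E < +oo)%E.

Let C (nu : R) := \int[mu]_t (p t * cos (2 * pi * (nu * t))).
Let S (nu : R) := \int[mu]_t (p t * sin (2 * pi * (nu * t))).
Let A (u : R) := \int[mu]_t (p t * p (t - u)).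
Let N := \int[mu]_t (p t ^+ 2).

Let mp : measurable_fun setT p.
Proof. by apply/measurable_EFinP; exact: measurable_int ip. Qed.

Let ip2 : mu.-integrable setT (fun x => (p x ^+ 2)%:E).
Proof.
apply/integrableP; split; first by apply/measurable_EFinP; exact: measurable_funX.
by under eq_integral do rewrite gee0_abs ?lee_fin ?sqr_ge0//.
Qed.

Let ip2u u : mu.-integrable setT (fun x : R => (p (x - u) ^+ 2)%:E).
Proof. exact: (integrable_translate (f := fun x => p x ^+ 2)). Qed.

Let ippu u : mu.-integrable setT (fun x : R => (p x * p (x - u))%:E).
Proof. by apply: integrable_mul_sq => //; exact: measurable_translate. Qed.

(** In the square, written as a double integral, the difference [u] of the two
variables is substituted for one of them; the other one then integrates to the
autocorrelation. *)
Lemma fourier_sq_autocorrelation nu :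
  C nu ^+ 2 + S nu ^+ 2 = \int[mu]_u (A u * cos (2 * pi * (nu * u))).
Proof.
have icos := integrableM_le1 ip (measurable_cos_bilin nu) (fun x => norm_cos_le1 _).
have isin := integrableM_le1 ip (measurable_sin_bilin nu) (fun x => norm_sin_le1 _).
have inner t : cos (2 * pi * (nu * t)) * C nu + sin (2 * pi * (nu * t)) * S nu =
    \int[mu]_u (p (t - u) * cos (2 * pi * (nu * u))).
  rewrite /C /S -!RintegralZl// -RintegralD//; first last.
  - exact: (integrableZl measurableT _ isin).
  - exact: (integrableZl measurableT _ icos).
  rewrite -(Rintegral_reflect (f := fun s => _) t); last first.
    apply: measurable_funD; (apply: measurable_funM => //; apply: measurable_funM => //).
      exact: measurable_cos_bilin.
    exact: measurable_sin_bilin.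
  apply: eq_Rintegral => u _.
  rewrite -[in RHS](subKr t u) [in RHS]mulrBr [in RHS]mulrBr cosB subKr; ring.
have -> : C nu ^+ 2 + S nu ^+ 2 =
    \int[mu]_t \int[mu]_u (p t * p (t - u) * cos (2 * pi * (nu * u))).
  rewrite !expr2 {1}/C {2}/S -!RintegralZr// -RintegralD//; first last.
  - exact: (integrableZr measurableT _ isin).
  - exact: (integrableZr measurableT _ icos).
  apply: eq_Rintegral => t _.
  rewrite -(mulrA (p t) (cos _)) -(mulrA (p t) (sin _)) -mulrDr inner -RintegralZl//.
    by apply: eq_Rintegral => u _; rewrite mulrA.
  apply: (integrableM_le1 (p := fun u => p (t - u))).
  - exact: integrable_reflect.
  - exact: measurable_cos_bilin.
  - by move=> x; exact: norm_cos_le1.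
have := Rfubini (integrable_autocorrelation ip (measurable_cos_bilin nu)
  (fun x => norm_cos_le1 _)).
rewrite /= => ->; apply: eq_Rintegral => u _.
by rewrite RintegralZr//; exact: ippu.
Qed.

Let iA : mu.-integrable setT (EFin \o A).
Proof.
have mc : measurable_fun setT (cst (1 : R) : R -> R) by exact: measurable_cst.
have c1 (z : R) : `|cst (1 : R) z| <= 1 by rewrite /= normr1.
have [h _] := integrable_Rintegral2 (integrable_autocorrelation ip mc c1).
apply: eq_integrable h => // u _ /=; congr (_%:E).
by apply: eq_Rintegral => t _; rewrite mulr1.
Qed.

(** Fubini's theorem exchanges the frequency [nu] and the shift [u]; the integral in
[nu] is then the Poisson kernel. *)
Lemma weighted_fourier_sq e : 0 < e ->
  [/\ mu.-integrable setT
        (fun nu => (poisson_weight e nu * (C nu ^+ 2 + S nu ^+ 2))%:E),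
      \int[mu]_nu (poisson_weight e nu * (C nu ^+ 2 + S nu ^+ 2)) =
        \int[mu]_u (A u * poisson_kernel e u) &
      mu.-integrable setT (fun u => (A u * poisson_kernel e u)%:E)].
Proof.
move=> e0; have iw := integrable_poisson_weight e0.
have mc : measurable_fun setT (fun z : R * R => cos (2 * pi * (z.1 * z.2))).
  apply: (measurableT_comp (f := @cos R)).
    by apply: continuous_measurable_fun; exact: continuous_cos.
  by apply: measurable_funM => //; apply: measurable_funM.
have iT := integrable_tensor iw iA mc (fun z => norm_cos_le1 _).
have E1 nu : \int[mu]_u (poisson_weight e nu * A u * cos (2 * pi * (nu * u))) =
    poisson_weight e nu * (C nu ^+ 2 + S nu ^+ 2).
  rewrite fourier_sq_autocorrelation -RintegralZl//.
    by apply: eq_Rintegral => u _; rewrite -(mulrA (_ nu)).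
  apply: (integrableM_le1 iA); first exact: measurable_cos_bilin.
  by move=> x; exact: norm_cos_le1.
have E2 u : \int[mu]_nu (poisson_weight e nu * A u * cos (2 * pi * (nu * u))) =
    A u * poisson_kernel e u.
  rewrite -Rintegral_poisson_weight_cos// -RintegralZl//.
    by apply: eq_Rintegral => nu _; rewrite [RHS]mulrCA -(mulrA (_ nu)).
  apply: (integrableM_le1 iw); last by move=> x; exact: norm_cos_le1.
  by under eq_fun do rewrite (mulrC _ u); exact: measurable_cos_bilin.
split; first last.
  by apply: eq_integrable (integrable_Rintegral2 iT).1 => // u _ /=; rewrite E2.
- have := Rfubini iT => /=.
  by under eq_Rintegral do rewrite E1; under [RHS]eq_Rintegral do rewrite E2.
-  by apply: eq_integrable (integrable_Rintegral1 iT).1 => // nu _ /=; rewrite E1.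
Qed.

Let A_ge u (D : R) : \int[mu]_t ((p t - p (t - u)) ^+ 2) <= D -> N - D / 2 <= A u.
Proof.
suff -> : \int[mu]_t ((p t - p (t - u)) ^+ 2) = 2 * (N - A u) by lra.
have iN : mu.-integrable setT (fun t => (p t ^+ 2 + p (t - u) ^+ 2)%:E).
  by under eq_fun do rewrite EFinD; exact: integrableD.
have iA2 : mu.-integrable setT (fun t => (2 * (p t * p (t - u)))%:E).
  by under eq_fun do rewrite EFinM; exact: integrableZl.
have -> : \int[mu]_t ((p t - p (t - u)) ^+ 2) =
    \int[mu]_t ((p t ^+ 2 + p (t - u) ^+ 2) - 2 * (p t * p (t - u))).
  by apply: eq_Rintegral => t _; ring.
rewrite RintegralB// RintegralD//; last exact: ip2u.
rewrite RintegralZl//; last exact: ippu.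
rewrite (Rintegral_translate (f := fun t => p t ^+ 2)); last exact: measurable_funX.
by rewrite -/N -/(A u); ring.
Qed.

Let N0 : 0 <= N. Proof. by apply: Rintegral_ge0 => x _; exact: sqr_ge0. Qed.

Let A_geN u : - N <= A u.
Proof.
suff : 0 <= 2 * (N + A u) by lra.
have iN : mu.-integrable setT (fun t => (p t ^+ 2 + p (t - u) ^+ 2)%:E).
  by under eq_fun do rewrite EFinD; exact: integrableD.
have iA2 : mu.-integrable setT (fun t => (2 * (p t * p (t - u)))%:E).
  by under eq_fun do rewrite EFinM; exact: integrableZl.
have -> : 2 * (N + A u) = \int[mu]_t ((p t + p (t - u)) ^+ 2).
  have -> : \int[mu]_t ((p t + p (t - u)) ^+ 2) =
      \int[mu]_t ((p t ^+ 2 + p (t - u) ^+ 2) + 2 * (p t * p (t - u))).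
    by apply: eq_Rintegral => t _; ring.
  rewrite RintegralD// RintegralD//; last exact: ip2u.
  rewrite RintegralZl//; last exact: ippu.
  rewrite (Rintegral_translate (f := fun t => p t ^+ 2)); last exact: measurable_funX.
  by rewrite -/N -/(A u); ring.
by apply: Rintegral_ge0 => x _; exact: sqr_ge0.
Qed.

(** Away from the origin the Poisson kernel is of order [e]; the comparison with the
kernel for [e = 1] makes the bound integrable. *)
Lemma poisson_kernel_tail (e r u : R) : 0 < e -> 0 < r -> r <= `|u| ->
  poisson_kernel e u <= e * (1 + ((2 * pi * r) ^+ 2)^-1) * poisson_kernel 1 u.
Proof.
move=> e0 r0 ru; have pi0 := pi_gt0 R; rewrite /poisson_kernel mulr1 expr1n.
set x := 2 * pi * u; set y := 2 * pi * r.
have y0 : 0 < y by rewrite !mulr_gt0.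
have xy : y ^+ 2 <= x ^+ 2.
  rewrite -[x ^+ 2]ger0_norm ?sqr_ge0// normrX lerXn2r ?nnegrE ?(ltW y0)//.
  by rewrite /x normrM ger0_norm ?mulr_ge0 ?(ltW pi0)// ler_wpM2l// mulr_ge0// ltW.
have x1 : 0 < 1 + x ^+ 2 by rewrite ltr_pwDl ?sqr_ge0.
have x2 : 0 < e ^+ 2 + x ^+ 2 by rewrite ltr_pwDl ?sqr_ge0// exprn_gt0.
rewrite ler_pdivrMr// (_ : _ * _ * _ * _ = (2 * e) *
  ((1 + (y ^+ 2)^-1) * (e ^+ 2 + x ^+ 2) / (1 + x ^+ 2))); last by ring.
rewrite ler_peMr ?mulr_ge0 ?(ltW e0)// ler_pdivlMr// mul1r.
have : 1 <= (y ^+ 2)^-1 * x ^+ 2.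
  by rewrite mulrC ler_pdivlMr ?mul1r// exprn_gt0.
have : 0 <= (y ^+ 2)^-1 * e ^+ 2 by rewrite mulr_ge0 ?invr_ge0 ?sqr_ge0.
by have := sqr_ge0 e; rewrite mulrDl mul1r mulrDr; lra.
Qed.

(** Half of the Plancherel theorem for a real function in L1 and L2. Damping the
spectrum by the Poisson weight turns its energy into the autocorrelation
integrated against an approximate identity, which tends to the value of the
autocorrelation at 0, that is, to the energy of [p]. *)
Lemma real_plancherel_le :
  (\int[mu]_x (p x ^+ 2)%:E <= \int[mu]_nu (C nu ^+ 2 + S nu ^+ 2)%:E)%E.
Proof.
have -> : (\int[mu]_x (p x ^+ 2)%:E = N%:E)%E.
  by rewrite /N fineK//; exact: integrable_fin_num.
apply/lee_addgt0Pr => d d0.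
have [r r0 hr] := L2_translate_near mp p2 d0.
have [K K0 tail] : exists2 K, 0 <= K & forall e u, 0 < e -> r <= `|u| ->
    poisson_kernel e u <= e * K * poisson_kernel 1 u.
  exists (1 + ((2 * pi * r) ^+ 2)^-1); first by rewrite addr_ge0// invr_ge0 sqr_ge0.
  by move=> *; exact: poisson_kernel_tail.
(* [e] is small enough for the contribution of the shifts of size at least [r] to be
at most half of the tolerance [d]; the other half comes from the smaller shifts. *)
have [e e0 eNK] : exists2 e, 0 < e & 2 * N * e * K <= d / 2.
  have NK : 0 <= N * K by rewrite mulr_ge0.
  have e1 : 0 < 4 * (N * K) + 1 by rewrite ltr_wpDl// mulr_ge0.
  exists (d / (4 * (N * K) + 1)); first by rewrite divr_gt0.
  rewrite (_ : _ * _ * _ * _ = d / 2 * (4 * (N * K) / (4 * (N * K) + 1))).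
    rewrite ler_piMr ?divr_ge0 ?(ltW d0)// ler_pdivrMr// mul1r; lra.
  by field; rewrite gt_eqF.
have iP (e' : R) : 0 < e' -> mu.-integrable setT (EFin \o poisson_kernel e').
  move=> e'0; apply/integrableP; split.
    apply/measurable_EFinP; apply: continuous_measurable_fun.
    exact: continuous_poisson_kernel.
  under eq_integral do rewrite /= ger0_norm ?poisson_kernel_ge0//.
  by rewrite integral_poisson_kernel// ltry.
have IP (e' : R) : 0 < e' -> \int[mu]_u poisson_kernel e' u = 1.
  by move=> e'0; rewrite /Rintegral integral_poisson_kernel.
have IPk (k e' : R) : 0 < e' -> \int[mu]_u (k * poisson_kernel e' u) = k.
  by move=> e'0; rewrite RintegralZl ?IP ?mulr1//; exact: iP.
have low u : (N - d / 2) * poisson_kernel e u - 2 * N * e * K * poisson_kernel 1 u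
    <= A u * poisson_kernel e u.
  have P0 := poisson_kernel_ge0 u e0; have P1 := poisson_kernel_ge0 u ltr01.
  have [ur|ur] := ltP `|u| r.
    have : (N - d / 2) * poisson_kernel e u <= A u * poisson_kernel e u.
      rewrite ler_wpM2r// A_ge//.
      have /fine_le := hr u ur; apply => //.
      apply: integrable_fin_num => //.
      rewrite (_ : (fun _ => _) = (fun x =>
        (p x ^+ 2)%:E + (p (x - u) ^+ 2)%:E - 2%:E * (p x * p (x - u))%:E)%E).
        by apply: integrableB => //; [exact: integrableD|exact: integrableZl].
      by apply/funext => x; rewrite -EFinM -!EFinD; congr (_%:E); ring.
    by apply: le_trans; rewrite gerBl mulr_ge0// mulr_ge0// mulr_ge0 ?(ltW e0)// mulr_ge0.
  have h1 := tail _ _ e0 ur.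
  have h2 : - N * poisson_kernel e u <= A u * poisson_kernel e u.
    by rewrite ler_wpM2r.
  apply: le_trans h2.
  have h3 : 2 * N * poisson_kernel e u <= 2 * N * (e * K * poisson_kernel 1 u).
    by rewrite ler_wpM2l// mulr_ge0.
  have h4 : 0 <= d / 2 * poisson_kernel e u by rewrite mulr_ge0// divr_ge0// ltW.
  by move: h3 h4; lra.
have [iW EW iAP] := weighted_fourier_sq e0.
have lowN : N - d <= \int[mu]_nu (poisson_weight e nu * (C nu ^+ 2 + S nu ^+ 2)).
  have ilow : mu.-integrable setT (fun u => ((N - d / 2) * poisson_kernel e u -
      2 * N * e * K * poisson_kernel 1 u)%:E).
    under eq_fun do rewrite EFinB.
    apply: integrableB => //.
      exact: (integrableZl measurableT _ (iP _ e0)).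
    exact: (integrableZl measurableT _ (iP _ ltr01)).
  rewrite EW; apply: (@le_trans _ _ (\int[mu]_u ((N - d / 2) * poisson_kernel e u -
      2 * N * e * K * poisson_kernel 1 u))); last first.
    by apply: le_Rintegral => // u _; exact: low.
  rewrite RintegralB//; first last.
  - exact: (integrableZl measurableT _ (iP _ ltr01)).
  - exact: (integrableZl measurableT _ (iP _ e0)).
  by rewrite !IPk//; move: eNK; lra.
apply: (@le_trans _ _ ((\int[mu]_nu
    (poisson_weight e nu * (C nu ^+ 2 + S nu ^+ 2)))%:E + d%:E)%E).
  by rewrite -EFinD lee_fin -lerBlDr.
apply: leeD => //; rewrite /Rintegral fineK; last exact: integrable_fin_num.
(* The weighted spectral energy is integrable, hence measurable; dividing by the
positive weight gives the measurability of the spectral energy. *)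
have mCS : measurable_fun setT (fun nu => C nu ^+ 2 + S nu ^+ 2).
  rewrite (_ : (fun _ => _) = (fun nu => (poisson_weight e nu)^-1 *
      (poisson_weight e nu * (C nu ^+ 2 + S nu ^+ 2)))).
    apply: measurable_funM.
      rewrite /poisson_weight; under eq_fun do rewrite -expRN opprK.
      have m : measurable_fun setT (fun x : R => e * `|x|).
        by apply: measurable_funM => //; exact: normr_measurable.
      exact: measurableT_comp m.
    by apply/measurable_EFinP; exact: measurable_int iW.
  by apply/funext => nu; rewrite mulrA mulVf ?mul1r// gt_eqF// poisson_weight_gt0.
apply: ge0_le_integral => //.
- move=> x _; rewrite lee_fin mulr_ge0 ?(ltW (poisson_weight_gt0 _ _))//.
  by rewrite addr_ge0 ?sqr_ge0.
- exact: measurable_int iW.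
- exact/measurable_EFinP.
- move=> x _; rewrite lee_fin ler_piMl ?addr_ge0 ?sqr_ge0//.
  exact: poisson_weight_le1.
Qed.

End Real.
End RealPlancherel.

Section ParameterIntegral.
Context d1 d2 (T1 : measurableType d1) (T2 : measurableType d2) (R : realType).
Variable m2 : {sigma_finite_measure set T2 -> \bar R}.

(** The integrals of the positive and of the negative part depend measurably on the
parameter by Tonelli's theorem. *)
Lemma measurable_parameter_Rintegral (f : T1 * T2 -> R) (D : set T2) :
  measurable D -> measurable_fun setT f ->
  measurable_fun setT (fun x => \int[m2]_(y in D) f (x, y)).
Proof.
move=> mD mf; rewrite /Rintegral; apply: measurableT_comp.
  exact: fine_measurable.
pose g z := (f z * \1_D z.2)%:E.
have mg : measurable_fun setT g.
  apply/measurable_EFinP; apply: measurable_funM => //.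
  exact: measurableT_comp (measurable_indic mD) measurable_snd.
rewrite (_ : (fun _ => _) = (fun x => (\int[m2]_y g^\+ (x, y) -
    \int[m2]_y g^\- (x, y))%E)).
  apply: emeasurable_funB.
  - by apply: measurable_fun_fubini_tonelli_F => //; exact: measurable_funepos.
  - by apply: measurable_fun_fubini_tonelli_F => //; exact: measurable_funeneg.
apply/funext => x; rewrite integral_mkcond integralE.
have E : (fun y => (f (x, y))%:E) \_ D = g \o (fun y => (x, y)).
  apply/funext => y; rewrite patchE /g /= indicE.
  by case: (y \in D); rewrite ?mulr1 ?mulr0.
by rewrite E funepos_comp funeneg_comp.
Qed.

Lemma cmeasurable_parameter_cintegral (f : T1 * T2 -> R[i]) (D : set T2) :
  measurable D -> cmeasurable f ->
  cmeasurable (fun x => cintegral m2 D (fun y => f (x, y))).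
Proof.
move=> mD [f1 f2]; split.
- exact: (measurable_parameter_Rintegral mD f1).
- exact: (measurable_parameter_Rintegral mD f2).
Qed.

End ParameterIntegral.

Section ComplexPlancherel.
Context (R : realType).
Local Notation mu := (@lebesgue_measure R).

Definition fourier (f : R -> R[i]) (nu : R) : R[i] :=
  cintegral mu setT (fun t => f t * e2ipi (- (nu * t))).

Lemma measurable_cos_trans (p : R -> R) : measurable_fun setT p ->
  measurable_fun setT (fun nu : R => \int[mu]_t (p t * cos (2 * pi * (nu * t)))).
Proof.
move=> mp.
have h : measurable_fun setT
    (fun z : R * R => p z.2 * cos (2 * pi * (z.1 * z.2))).
  apply: measurable_funM; first exact: measurableT_comp mp measurable_snd.
  apply: (measurableT_comp (f := @cos R)).
    by apply: continuous_measurable_fun; exact: continuous_cos.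
  by apply: measurable_funM => //; apply: measurable_funM.
exact: (measurable_parameter_Rintegral mu measurableT h).
Qed.

Lemma measurable_sin_trans (p : R -> R) : measurable_fun setT p ->
  measurable_fun setT (fun nu : R => \int[mu]_t (p t * sin (2 * pi * (nu * t)))).
Proof.
move=> mp.
have h : measurable_fun setT
    (fun z : R * R => p z.2 * sin (2 * pi * (z.1 * z.2))).
  apply: measurable_funM; first exact: measurableT_comp mp measurable_snd.
  apply: (measurableT_comp (f := @sin R)).
    by apply: continuous_measurable_fun; exact: continuous_sin.
  by apply: measurable_funM => //; apply: measurable_funM.
exact: (measurable_parameter_Rintegral mu measurableT h).
Qed.

(** Averaging the energy of the spectrum over [nu] and [- nu] removes the cross
terms between the real and the imaginary part of [f]. *)
Lemma plancherel_le (f : R -> R[i]) : cintegrable mu setT f -> inL2 mu f ->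
  (L2normsq mu setT f <= L2normsq mu setT (fourier f))%E.
Proof.
move=> [ip iq] [[mp mq] f2].
pose p t := complex.Re (f t); pose q t := complex.Im (f t).
pose C (u : R -> R) nu := \int[mu]_t (u t * cos (2 * pi * (nu * t))).
pose S (u : R -> R) nu := \int[mu]_t (u t * sin (2 * pi * (nu * t))).
have mC u : measurable_fun setT u -> measurable_fun setT (C u).
  exact: measurable_cos_trans.
have mS u : measurable_fun setT u -> measurable_fun setT (S u).
  exact: measurable_sin_trans.
have ge0E (u : R -> R) x : setT x -> (0 <= (u x ^+ 2)%:E)%E.
  by move=> _; rewrite lee_fin sqr_ge0.
have msq (u : R -> R) : measurable_fun setT u ->
    measurable_fun setT (fun x => (u x ^+ 2)%:E).
  by move=> mu_; apply/measurable_EFinP; exact: measurable_funX.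
have sqD (u v : R -> R) : measurable_fun setT u -> measurable_fun setT v ->
    (\int[mu]_x (u x ^+ 2 + v x ^+ 2)%:E =
     \int[mu]_x (u x ^+ 2)%:E + \int[mu]_x (v x ^+ 2)%:E)%E.
  move=> mu_ mv_; under eq_integral do rewrite EFinD.
  by apply: ge0_integralD => //; [exact: ge0E|exact: msq|exact: ge0E|exact: msq].
have normE : L2normsq mu setT f =
    (\int[mu]_x (p x ^+ 2)%:E + \int[mu]_x (q x ^+ 2)%:E)%E.
  by rewrite -sqD//; apply: eq_integral => x _; rewrite normc_sq.
have p2 : (\int[mu]_x (p x ^+ 2)%:E < +oo)%E.
  apply: le_lt_trans f2; rewrite normE leeDl//.
  by apply: integral_ge0 => x _; rewrite lee_fin sqr_ge0.
have q2 : (\int[mu]_x (q x ^+ 2)%:E < +oo)%E.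
  apply: le_lt_trans f2; rewrite normE leeDr//.
  by apply: integral_ge0 => x _; rewrite lee_fin sqr_ge0.
have icos (u : R -> R) nu : mu.-integrable setT (EFin \o u) ->
    mu.-integrable setT (fun t => (u t * cos (2 * pi * (nu * t)))%:E).
  move=> iu; apply: integrableM_le1 => //; first exact: measurable_cos_bilin.
  by move=> x; exact: norm_cos_le1.
have isin (u : R -> R) nu : mu.-integrable setT (EFin \o u) ->
    mu.-integrable setT (fun t => (u t * sin (2 * pi * (nu * t)))%:E).
  move=> iu; apply: integrableM_le1 => //; first exact: measurable_sin_bilin.
  by move=> x; exact: norm_sin_le1.
have fhatE nu : Normc.normc (fourier f nu) ^+ 2 =
    (C p nu + S q nu) ^+ 2 + (C q nu - S p nu) ^+ 2.
  rewrite normc_sq /fourier /cintegral /=; congr (_ ^+ 2 + _ ^+ 2).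
  - rewrite -RintegralD//; [|exact: icos|exact: isin].
    apply: eq_Rintegral => t _; rewrite ReM /= mulrN cosN sinN.
    by rewrite mulrN opprK.
  - rewrite -RintegralB//; [|exact: icos|exact: isin].
    apply: eq_Rintegral => t _; rewrite ImM /= mulrN cosN sinN.
    by rewrite mulrN addrC.
have CN u nu : C u (- nu) = C u nu.
  by apply: eq_Rintegral => t _; rewrite mulNr mulrN cosN.
have SN (u : R -> R) nu : mu.-integrable setT (EFin \o u) ->
    S u (- nu) = - S u nu.
  move=> iu; rewrite -[RHS]mulN1r /S -RintegralZl//; last exact: isin.
  by apply: eq_Rintegral => t _; rewrite mulNr mulrN sinN mulN1r mulrN.
pose G nu := (C p nu + S q nu) ^+ 2 + (C q nu - S p nu) ^+ 2.
have mG : measurable_fun setT (EFin \o G).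
  apply/measurable_EFinP; apply: measurable_funD; apply: measurable_funX.
    by apply: measurable_funD; [exact: mC|exact: mS].
  by apply: measurable_funB; [exact: mC|exact: mS].
have G0 x : (0 <= (G x)%:E)%E by rewrite lee_fin addr_ge0 ?sqr_ge0.
have fhatG : L2normsq mu setT (fourier f) = (\int[mu]_nu (G nu)%:E)%E.
  by apply: eq_integral => nu _; rewrite fhatE.
have half (X : \bar R) : (0 <= X)%E -> ((1 / 2)%:E * X + (1 / 2)%:E * X = X)%E.
  move=> X0; rewrite -ge0_muleDl ?lee_fin// -EFinD (_ : 1 / 2 + 1 / 2 = 1 :> R).
    by rewrite mul1e.
  by lra.
rewrite fhatG -(half (\int[mu]_nu (G nu)%:E)%E) ?integral_ge0//.
rewrite -[X in (_ <= _ + _ * X)%E](ge0_integral_opp mG G0).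
have mGN : measurable_fun setT (fun nu : R => (EFin \o G) (- nu)).
  by apply: (measurableT_comp mG); exact: oppr_measurable.
rewrite -!ge0_integralZl ?lee_fin//; last by move=> x _; exact: G0.
rewrite -ge0_integralD//; first last.
- exact: measurable_funeM.
- by move=> x _; rewrite mule_ge0 ?lee_fin//; exact: G0.
- exact: measurable_funeM.
- by move=> x _; rewrite mule_ge0 ?lee_fin//; exact: G0.
have E (nu : R) : ((1 / 2)%:E * (G nu)%:E + (1 / 2)%:E * (EFin \o G) (- nu)%R =
    (C p nu ^+ 2 + S p nu ^+ 2 + (C q nu ^+ 2 + S q nu ^+ 2))%R%:E)%E.
  by rewrite /= /G !CN !SN// -!EFinM -EFinD; congr (_%:E); field.
under eq_integral do rewrite E EFinD.
have mCS u : measurable_fun setT u ->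
    measurable_fun setT (fun nu => (C u nu ^+ 2 + S u nu ^+ 2)%:E).
  move=> mu_; apply/measurable_EFinP.
  by apply: measurable_funD; apply: measurable_funX; [exact: mC|exact: mS].
rewrite ge0_integralD//; first last.
- exact: mCS.
- by move=> x _; rewrite lee_fin addr_ge0 ?sqr_ge0.
- exact: mCS.
- by move=> x _; rewrite lee_fin addr_ge0 ?sqr_ge0.
by rewrite normE; apply: leeD; exact: real_plancherel_le.
Qed.

End ComplexPlancherel.

(** * Bessel's inequality and the Hilbert-Schmidt norm *)

Section InnerProduct.
Context (R : realType).
Local Notation mu := (@lebesgue_measure R).
Implicit Types f g h : R -> R[i].

Lemma cintegrable_inner f g : inL2 mu f -> inL2 mu g ->
  cintegrable mu setT (fun t => f t * conjc (g t)).
Proof. by move=> f2 g2; apply: cintegrableM => //; exact: inL2J. Qed.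

Lemma innerDl f g h : inL2 mu f -> inL2 mu g -> inL2 mu h ->
  inner (fun t => f t + g t) h = inner f h + inner g h.
Proof.
move=> f2 g2 h2; rewrite /inner -cintegralD//; [|exact: cintegrable_inner..].
by apply: cintegral_eq => t _; rewrite mulrDl.
Qed.

Lemma innerZl (c : R[i]) f h : inL2 mu f -> inL2 mu h ->
  inner (fun t => c * f t) h = c * inner f h.
Proof.
move=> f2 h2; rewrite /inner -cintegralZ//; last exact: cintegrable_inner.
by apply: cintegral_eq => t _; rewrite mulrA.
Qed.

Lemma innerJ f g : inL2 mu f -> inL2 mu g -> inner g f = conjc (inner f g).
Proof.
move=> f2 g2; rewrite /inner -cintegralJ//; last exact: cintegrable_inner.
by apply: cintegral_eq => t _; rewrite rmorphM /= conjcK mulrC.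
Qed.

Lemma L2normsq_inner f : inL2 mu f ->
  L2normsq mu setT f = (complex.Re (inner f f))%:E.
Proof.
move=> f2; rewrite /inner /cintegral /= /Rintegral fineK.
  by apply: eq_integral => t _; rewrite normc_sq ReM ReJ ImJ mulrN opprK.
by apply: integrable_fin_num => //; exact: (cintegrable_inner f2 f2).1.
Qed.

(** The norm of the difference between [f] and its projection on the span of
the first [N] vectors is nonnegative. *)
Lemma bessel (e : nat -> R -> R[i]) f N : (forall n, inL2 mu (e n)) ->
  (forall i j, inner (e i) (e j) = (i == j)%:R) -> inL2 mu f ->
  (\sum_(n < N) (Normc.normc (inner f (e n)) ^+ 2)%:E <= L2normsq mu setT f)%E.
Proof.
move=> e2 eON f2; pose c n := inner f (e n).
pose s t := \sum_(n < N) c n * e n t.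
have s2 : inL2 mu s by apply: inL2_sum => n; exact: inL2Z.
have is_ h : inL2 mu h -> inner s h = \sum_(n < N) c n * inner (e n) h.
  move=> h2; rewrite /inner.
  have ie (n : 'I_N) : cintegrable mu setT (fun t => c n * e n t * conjc (h t)).
    by apply: cintegrable_inner => //; exact: inL2Z.
  have [_] := cintegral_sum (index_enum 'I_N) measurableT ie.
  rewrite (_ : (fun _ => _) = (fun t => s t * conjc (h t))); last first.
    by apply/funext => t; rewrite mulr_suml.
  by move=> ->; apply: eq_bigr => n _; exact: innerZl.
have se (n : 'I_N) : inner s (e n) = c n.
  rewrite is_// (bigD1 n)//= eON eqxx mulr1 big1 ?addr0// => m mn.
  by rewrite eON (negbTE (mn : (m : nat) != n)) mulr0.
have isf : inner s f = \sum_(n < N) (Normc.normc (c n) ^+ 2)%:C%C.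
  rewrite is_//; apply: eq_bigr => n _; rewrite (innerJ f2 (e2 n)) -/(c n).
  exact: mulrJ_normc_sq.
have iss : inner s s = \sum_(n < N) (Normc.normc (c n) ^+ 2)%:C%C.
  rewrite is_//; apply: eq_bigr => n _; rewrite (innerJ s2 (e2 n)) se.
  exact: mulrJ_normc_sq.
pose u t := f t + (-1) * s t.
have ms2 : inL2 mu (fun t => (-1) * s t) by exact: inL2Z.
have u2 : inL2 mu u by exact: inL2D.
have := L2normsq_ge0 mu setT u; rewrite (L2normsq_inner u2) (L2normsq_inner f2).
have -> : inner u u = inner f f - \sum_(n < N) (Normc.normc (c n) ^+ 2)%:C%C.
  set X := \sum_(n < N) _ in isf iss *.
  have XJ : conjc X = X by rewrite -iss -innerJ.
  have ufE h : inL2 mu h -> inner u h = inner f h - inner s h.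
    by move=> h2; rewrite [LHS]innerDl// innerZl// mulN1r.
  have fuE : inner f u = inner f f - X.
    by rewrite (innerJ u2 f2) ufE// isf conjcB XJ -innerJ.
  have suE : inner s u = 0.
    by rewrite (innerJ u2 s2) ufE// iss (innerJ s2 f2) isf XJ subrr conjc0.
  by rewrite ufE// fuE suE subr0.
rewrite sumEFin !lee_fin ReD ReN.
have -> : complex.Re (\sum_(n < N) (Normc.normc (c n) ^+ 2)%:C%C) =
    \sum_(n < N) Normc.normc (c n) ^+ 2.
  by elim/big_rec2: _ => // n x y _ <-; rewrite ReD.
by rewrite subr_ge0.
Qed.

Lemma ae_inL2_section (k : R * R -> R[i]) : inL2 (mu \x mu)%E k ->
  {ae mu, forall t, inL2 mu (fun s => k (t, s))}.
Proof.
move=> [mk k2]; pose K t := (\int[mu]_s (Normc.normc (k (t, s)) ^+ 2)%:E)%E.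
have mk2 := measurable_normc_sqE mk.
have k0 z : (0 <= (Normc.normc (k z) ^+ 2)%:E)%E by rewrite lee_fin sqr_ge0.
have mK : measurable_fun setT K.
  exact: (@measurable_fun_fubini_tonelli_F _ _ _ _ R mu _ mk2 k0).
have K0 t : (0 <= K t)%E by exact: integral_ge0.
have iK : mu.-integrable setT K.
  apply/integrableP; split => //.
  under eq_integral do rewrite gee0_abs//.
  by rewrite -[ltLHS](fubini_tonelli1 (m1 := mu) (m2 := mu) _ mk2 k0).
have := integrable_ae measurableT iK; apply: filterS => t /(_ I) Kt.
split; first exact: cmeasurable_comp mk (pair1_measurable t).
by rewrite /L2normsq -ge0_fin_numE// -/(K t).
Qed.

(** For almost every [t], Bessel's inequality for the section [k (t, _)] bounds
the sum over [n] of the squared values at [t]; integrating in [t] gives the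
Hilbert-Schmidt bound for an operator with kernel [k]. *)
Lemma sum_L2normsq_le_kernel (k : R * R -> R[i]) (e G : nat -> R -> R[i]) N :
  inL2 (mu \x mu)%E k -> (forall n, inL2 mu (e n)) ->
  (forall i j, inner (e i) (e j) = (i == j)%:R) ->
  (forall n, cmeasurable (G n)) ->
  (forall n, {ae mu, forall t,
     G n t = cintegral mu setT (fun s => k (t, s) * e n s)}) ->
  (\sum_(n < N) L2normsq mu setT (G n) <= L2normsq (mu \x mu)%E setT k)%E.
Proof.
move=> [mk k2] e2 eON mG GE.
pose K t := (\int[mu]_s (Normc.normc (k (t, s)) ^+ 2)%:E)%E.
have mk2 := measurable_normc_sqE mk.
have k0 z : (0 <= (Normc.normc (k z) ^+ 2)%:E)%E by rewrite lee_fin sqr_ge0.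
have kE : L2normsq (mu \x mu)%E setT k = (\int[mu]_t K t)%E.
  by rewrite /L2normsq fubini_tonelli1.
have mK : measurable_fun setT K.
  exact: (@measurable_fun_fubini_tonelli_F _ _ _ _ R mu _ mk2 k0).
have K0 t : (0 <= K t)%E by exact: integral_ge0.
rewrite kE /L2normsq -ge0_integral_sum//; first last.
- by move=> n x _; rewrite lee_fin sqr_ge0.
- by move=> n; exact: measurable_normc_sqE (mG n).
apply: ae_ge0_le_integral => //.
- by move=> t _; apply: sume_ge0 => n _; rewrite lee_fin sqr_ge0.
- by apply: emeasurable_sum => n; exact: measurable_normc_sqE (mG n).
have GE' : {ae mu, forall t, forall n,
     G n t = cintegral mu setT (fun s => k (t, s) * e n s)}.
  exact: (ae_foralln GE).
apply: ae_imply2 (ae_inL2_section (conj mk k2)) GE' => t kt GEt _.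
have kt2 : inL2 mu (fun s => conjc (k (t, s))) by exact: inL2J.
have -> : K t = L2normsq mu setT (fun s => conjc (k (t, s))).
  by apply: eq_integral => s _; rewrite normc_sqJ.
apply: le_trans (bessel N e2 eON kt2); apply: lee_sum => n _.
rewrite lee_fin GEt -[in leRHS]normc_sqJ /inner -cintegralJ//; last first.
  by apply: cintegrable_inner.
rewrite le_eqVlt; apply/orP; left; apply/eqP; congr (Normc.normc _ ^+ 2).
by apply: cintegral_eq => s _; rewrite rmorphM /= !conjcK.
Qed.

End InnerProduct.

(** * Kernels and spreading functions *)

Section Spreading.
Context (R : realType).
Local Notation mu := (@lebesgue_measure R).
Local Notation mu2 := (mu \x mu)%E.
Implicit Types k : R * R -> R[i].

(** For a kernel [k] in the variables [t] and [s], the values on the line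
[t - s = b]. The spreading function at shift [b] is the Fourier transform of this
diagonal. *)
Definition diagonal k (b t : R) : R[i] := k (t, t - b).

Lemma cmeasurable_diagonal k : cmeasurable k ->
  cmeasurable (fun z : R * R => diagonal k z.1 z.2).
Proof.
move=> mk; apply: (cmeasurable_comp mk); apply: measurable_fun_pair.
  exact: measurable_snd.
by apply: measurable_funB; [exact: measurable_snd|exact: measurable_fst].
Qed.

Lemma cmeasurable_diagonal1 k b : cmeasurable k -> cmeasurable (diagonal k b).
Proof.
move=> mk.
exact: (cmeasurable_comp (cmeasurable_diagonal mk) (pair1_measurable b)).
Qed.

(** The reflection [b |-> t - b] turns the section at [t] into the points [t - b]. *)
Lemma L2normsq_diagonal k : cmeasurable k ->
  L2normsq mu2 setT k = (\int[mu]_b L2normsq mu setT (diagonal k b))%E.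
Proof.
move=> mk; have mk2 := measurable_normc_sqE mk.
have k0 z : (0 <= (Normc.normc (k z) ^+ 2)%:E)%E by rewrite lee_fin sqr_ge0.
have md2 := measurable_normc_sqE (cmeasurable_diagonal mk).
have d0 (z : R * R) : (0 <= (Normc.normc (diagonal k z.1 z.2) ^+ 2)%:E)%E.
  by rewrite lee_fin sqr_ge0.
rewrite [LHS](fubini_tonelli1 (m1 := mu) (m2 := mu) _ mk2 k0).
rewrite [RHS](fubini_tonelli (m1 := mu) (m2 := mu) _ md2 d0).
apply: eq_integral => t _; rewrite /fubini_F.
have mt := measurableT_comp mk2 (pair1_measurable t).
by rewrite -(ge0_integral_reflect t mt)// => s; exact: k0.
Qed.

(** Truncation in the first variable, as in the integrals over [- N, N] whose limit
is the spreading function. *)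
Definition truncate_kernel (n : nat) k (z : R * R) : R[i] :=
  if `|z.1| <= n%:R then k z else 0.

Lemma measurable_norm_le (n : R) : measurable [set x : R | `|x| <= n].
Proof.
rewrite (_ : [set _ | _] = [set` `[- n, n]]); first exact: measurable_itv.
by apply/seteqP; split => x /=; rewrite in_itv/= -ler_norml.
Qed.

Lemma cmeasurable_truncate n k : cmeasurable k -> cmeasurable (truncate_kernel n k).
Proof.
move=> mk.
pose I (z : R * R) : R[i] := (\1_[set x : R | `|x| <= n%:R] z.1)%:C%C.
have -> : truncate_kernel n k = (fun z => I z * k z).
  apply/funext => z; rewrite /truncate_kernel /I indicE.
  case: ifPn => [zn|/negP zn]; first by rewrite mem_set// mul1r.
  by rewrite memNset// mul0r.
apply: cmeasurableM => //; split; last exact: measurable_cst.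
apply: measurableT_comp measurable_fst.
by apply: measurable_indic; exact: measurable_norm_le.
Qed.

Lemma truncate_kernel_cvg k : inL2 mu2 k ->
  (L2normsq mu2 setT (fun z => k z - truncate_kernel n k z)%R
     @[n --> \oo] --> 0)%E.
Proof.
move=> [mk k2].
have mt n := cmeasurable_truncate n mk.
have [_ _] : [/\ mu2.-integrable setT (cst 0%E : R * R -> \bar R),
    [sequence (\int[mu2]_z `|(Normc.normc (k z - truncate_kernel n k z)%R ^+ 2)%:E - 0|)%E]_n
      @ \oo --> 0%E &
    [sequence (\int[mu2]_z (Normc.normc (k z - truncate_kernel n k z)%R ^+ 2)%:E)%E]_n
      @ \oo --> (\int[mu2]_z (cst 0%E : R * R -> \bar R) z)%E].
  apply: (@dominated_convergence _ _ _ mu2 setT measurableT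
    (fun n z => (Normc.normc (k z - truncate_kernel n k z) ^+ 2)%:E) (cst 0%E)
    (fun z => (Normc.normc (k z) ^+ 2)%:E)).
  - by move=> n; apply: measurable_normc_sqE; exact: cmeasurableB mk (mt n).
  - exact: measurable_cst.
  - apply: aeW => z _; apply: cvg_near_cst.
    exists (Num.truncn `|z.1|).+1 => // n /= Nn.
    rewrite /truncate_kernel ifT ?subrr ?normc_sq ?expr0n ?addr0//=.
    by rewrite (le_trans (ltW (truncnS_gt _)))// ler_nat.
  - apply/integrableP; split; first exact: measurable_normc_sqE.
    by under eq_integral do rewrite gee0_abs ?lee_fin ?sqr_ge0//.
  - apply: aeW => z n _; rewrite gee0_abs ?lee_fin ?sqr_ge0// /truncate_kernel.
    by case: ifP => _; rewrite ?subr0// subrr normc_sq /= expr0n /= addr0 sqr_ge0.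
by rewrite integral0.
Qed.

End Spreading.

Section KernelSpreading.
Context (R : realType).
Local Notation mu := (@lebesgue_measure R).
Local Notation mu2 := (mu \x mu)%E.

Lemma cintegrable_modulation (f : R -> R[i]) (nu : R) : cintegrable mu setT f ->
  cintegrable mu setT (fun t => f t * e2ipi (- (nu * t))).
Proof.
move=> [ip iq].
have mN : measurable_fun setT (fun t : R => - (nu * t)).
  by apply: measurableT_comp => //; apply: measurable_funM.
have [mc ms] := cmeasurable_e2ipi mN.
have c1 x : `|complex.Re (e2ipi x : R[i])| <= 1 by exact: norm_cos_le1.
have s1 x : `|complex.Im (e2ipi x : R[i])| <= 1 by exact: norm_sin_le1.
split.
- under eq_fun do rewrite ReM EFinB.
  by apply: integrableB => //; exact: integrableM_le1.
- under eq_fun do rewrite ImM EFinD.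
  by apply: integrableD => //; exact: integrableM_le1.
Qed.

Lemma fourierB (f g : R -> R[i]) nu : cintegrable mu setT f ->
  cintegrable mu setT g ->
  fourier (fun t => f t - g t) nu = fourier f nu - fourier g nu.
Proof.
move=> fi gi; have fi' := cintegrable_modulation nu fi.
have gi' := cintegrable_modulation nu gi.
rewrite /fourier -[X in _ + X]mulN1r -cintegralZ// -cintegralD//.
  by apply: cintegral_eq => t _; ring.
exact: cintegrableZ.
Qed.

Lemma ae_inL2_diagonal (k : R * R -> R[i]) : inL2 mu2 k ->
  {ae mu, forall b, inL2 mu (diagonal k b)}.
Proof.
move=> [mk k2]; pose D b := L2normsq mu setT (diagonal k b).
have D0 b : (0 <= D b)%E by exact: L2normsq_ge0.
have mD : measurable_fun setT D.
  have md2 := measurable_normc_sqE (cmeasurable_diagonal mk).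
  have d0 (z : R * R) : (0 <= (Normc.normc (diagonal k z.1 z.2) ^+ 2)%:E)%E.
    by rewrite lee_fin sqr_ge0.
  exact: (@measurable_fun_fubini_tonelli_F _ _ _ _ R mu _ md2 d0).
have iD : mu.-integrable setT D.
  apply/integrableP; split => //.
  by under eq_integral do rewrite gee0_abs//; rewrite -L2normsq_diagonal.
have := integrable_ae measurableT iD; apply: filterS => b /(_ I) Db.
split; first exact: cmeasurable_diagonal1.
by rewrite -ge0_fin_numE ?L2normsq_ge0.
Qed.

Lemma inL2_itv (n : nat) : inL2 mu (fun t : R => Complex (`|t| <= n%:R)%R%:R 0).
Proof.
have E (t : R) : (`|t| <= n%:R)%R%:R = \1_[set x : R | `|x| <= n%:R] t :> R.
  rewrite indicE; case: (boolP (`|t| <= n%:R)) => tn; first by rewrite mem_set.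
  by rewrite memNset//; exact/negP.
have mI : measurable_fun setT (\1_[set x : R | `|x| <= n%:R] : R -> R).
  by apply: measurable_indic; exact: measurable_norm_le.
split.
  by split; [under eq_fun do rewrite E|exact: measurable_cst].
rewrite /L2normsq.
under eq_integral do rewrite normc_sq /= expr0n addr0 E.
rewrite (_ : (fun _ => _) =
    (fun x : R => (\1_[set x : R | `|x| <= n%:R] x)%:E)); last first.
  by apply/funext => x; rewrite indicE; case: (_ \in _); rewrite ?expr1n ?expr0n.
rewrite integral_indic//; last exact: measurable_norm_le.
rewrite setIT (_ : [set _ | _] = [set` `[- n%:R, n%:R]]).
  exact: lebesgue_measure_itvN_lty.
by apply/seteqP; split => x /=; rewrite in_itv/= -ler_norml.
Qed.

Lemma diagonal_truncate n (k : R * R -> R[i]) b t :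
  diagonal (truncate_kernel n k) b t = Complex (`|t| <= n%:R)%R%:R 0 * diagonal k b t.
Proof.
rewrite /diagonal /truncate_kernel/=; case: (`|t| <= n%:R).
  by rewrite -[LHS]mul1r.
by rewrite -[LHS](mul0r (k (t, t - b))).
Qed.

Lemma fourier_truncate n (k : R * R -> R[i]) b nu :
  fourier (diagonal (truncate_kernel n k) b) nu =
  cintegral mu `[- n%:R, n%:R] (fun t => k (t, t - b) * e2ipi (- (nu * t))).
Proof.
have E (t : R) : (t \in ([set` `[- n%:R, n%:R]] : set R)) = (`|t| <= n%:R).
  by apply/idP/idP; rewrite inE /= in_itv/= -ler_norml.
rewrite /fourier; apply: complex_eq; rewrite /cintegral /= [RHS]Rintegral_mkcond.
- apply: eq_Rintegral => t _; rewrite diagonal_truncate patchE E.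
  by case: ifP; rewrite ?mul1r ?mul0r.
- apply: eq_Rintegral => t _; rewrite diagonal_truncate patchE E.
  by case: ifP; rewrite ?mul1r ?mul0r.
Qed.

(** The spreading function is the Fourier transform of the diagonals of the
kernel. The Plancherel inequality is applied to almost every diagonal of the
difference of the truncated kernel and [K], and then the truncation is removed
in the limit. *)
Lemma kernel_le_spreading (kappa eta K : R * R -> R[i]) :
  inL2 mu2 kappa -> inL2 mu2 eta ->
  L2cvg mu2 setT (fun N x => cintegral mu `[- N%:R, N%:R]
     (fun t => kappa (t, t - x.1) * e2ipi (- (x.2 * t)))) eta ->
  inL2 mu2 K -> (forall b, cintegrable mu setT (diagonal K b)) ->
  cmeasurable (fun x => fourier (diagonal K x.1) x.2) ->
  (L2normsq mu2 setT (fun z => kappa z - K z)%R <=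
   L2normsq mu2 setT (fun x => eta x - fourier (diagonal K x.1) x.2)%R)%E.
Proof.
move=> k2 eta2 cvg_eta K2 iK mQ.
pose Q x := fourier (diagonal K x.1) x.2.
pose kn n := truncate_kernel n kappa.
pose en n (x : R * R) := cintegral mu `[- n%:R, n%:R]
     (fun t => kappa (t, t - x.1) * e2ipi (- (x.2 * t))).
have mkn n : cmeasurable (kn n) by apply: cmeasurable_truncate; case: k2.
have [mk _] := k2; have [meta _] := eta2; have [mK _] := K2.
have men n : cmeasurable (en n).
  have mg : cmeasurable (fun z : (R * R) * R =>
      kappa (z.2, z.2 - z.1.1) * e2ipi (- (z.1.2 * z.2))).
    apply: cmeasurableM.
      apply: (cmeasurable_comp mk); apply: measurable_fun_pair => //.
      apply: measurable_funB => //.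
      exact: measurableT_comp measurable_fst measurable_fst.
    apply: cmeasurable_e2ipi; apply: measurableT_comp => //.
    apply: measurable_funM => //.
    exact: measurableT_comp measurable_snd measurable_fst.
  exact: (cmeasurable_parameter_cintegral mu (measurable_itv _) mg).
apply: (le_limit_young (Xn := fun n => L2normsq mu2 setT (fun z => kn n z - K z))
  (Yn := fun n => L2normsq mu2 setT (fun x => en n x - Q x))
  (Z := fun n => L2normsq mu2 setT (fun z => kappa z - kn n z))
  (W := fun n => L2normsq mu2 setT (fun x => en n x - eta x))).
- exact: L2normsq_ge0.
- move=> e n e0.
  have := L2normsq_young mu2 measurableT e0 (cmeasurableB (mkn n) mK)
    (cmeasurableB mk (mkn n)).
  rewrite (_ : (fun _ => _ + _) = (fun z => kappa z - K z))//.
  by apply/funext => z; ring.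
- move=> n; have f2 : inL2 mu2 (fun z => kn n z - K z).
    apply: inL2B => //; split; first exact: mkn.
    apply: le_lt_trans k2.2; apply: ge0_le_integral => //.
    + by move=> z _; rewrite lee_fin sqr_ge0.
    + exact: measurable_normc_sqE (mkn n).
    + exact: measurable_normc_sqE mk.
    + move=> z _; rewrite lee_fin /kn /truncate_kernel; case: ifP => // _.
      by rewrite normc_sq /= expr0n /= addr0 sqr_ge0.
  have mf := f2.1.
  rewrite L2normsq_diagonal//.
  have mg : cmeasurable (fun x => en n x - Q x) by exact: cmeasurableB.
  have mg2 := measurable_normc_sqE mg.
  have g0 (x : R * R) : (0 <= (Normc.normc (en n x - Q x) ^+ 2)%:E)%E.
    by rewrite lee_fin sqr_ge0.
  rewrite [leRHS](fubini_tonelli1 (m1 := mu) (m2 := mu) _ mg2 g0).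
  have md2 := measurable_normc_sqE (cmeasurable_diagonal mf).
  have d0 (z : R * R) :
      (0 <= (Normc.normc (diagonal (fun z => kn n z - K z) z.1 z.2) ^+ 2)%:E)%E.
    by rewrite lee_fin sqr_ge0.
  apply: ae_ge0_le_integral => //.
  + by move=> b _; exact: L2normsq_ge0.
  + exact: (@measurable_fun_fubini_tonelli_F _ _ _ _ R mu _ md2 d0).
  + by move=> b _; apply: integral_ge0 => nu _; exact: g0.
  + exact: (@measurable_fun_fubini_tonelli_F _ _ _ _ R mu _ mg2 g0).
  apply: ae_imply2 (ae_inL2_diagonal k2) (ae_inL2_diagonal f2) => b kb fb _.
  have ikn : cintegrable mu setT (diagonal (kn n) b).
    have := cintegrableM (inL2_itv n) kb.
    rewrite (_ : (fun _ => _ * _) = diagonal (kn n) b)//.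
    by apply/funext => t; rewrite diagonal_truncate.
  have ifb : cintegrable mu setT (diagonal (fun z => kn n z - K z) b).
    have := cintegrableD measurableT ikn (cintegrableZ (-1) measurableT (iK b)).
    rewrite (_ : (fun _ => _ + _) = diagonal (fun z => kn n z - K z) b)//.
    by apply/funext => t; rewrite mulN1r.
  apply: (le_trans (plancherel_le ifb fb)).
  rewrite le_eqVlt; apply/orP; left; apply/eqP.
  apply: eq_integral => nu _; congr (Normc.normc _ ^+ 2)%:E.
  by rewrite (fourierB nu ikn (iK b)) fourier_truncate.
- move=> e n e0.
  have := L2normsq_young mu2 measurableT e0 (cmeasurableB meta mQ)
    (cmeasurableB (men n) meta).
  rewrite (_ : (fun _ => _ + _) = (fun x => en n x - Q x))//.
  by apply/funext => z; rewrite /Q; ring.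
- exact: truncate_kernel_cvg.
- exact: cvg_eta.
Qed.

End KernelSpreading.

(** * Partial sums of Gabor multipliers *)

Section GaborKernel.
Context (R : realType).
Local Notation mu := (@lebesgue_measure R).
Local Notation mu2 := (mu \x mu)%E.

Lemma inL2_tfshift (b nu : R) (f : R -> R[i]) : inL2 mu f ->
  inL2 mu (tfshift b nu f).
Proof.
move=> f2; have [mfb fb2] := inL2_translate (- b) f2.
have me : cmeasurable (fun t : R => e2ipi (nu * t)).
  by apply: cmeasurable_e2ipi; apply: measurable_funM.
split; first exact: cmeasurableM me mfb.
rewrite /L2normsq /tfshift /modulation.
by under eq_integral do rewrite normc_sqM normc_sq_e2ipi mul1r.
Qed.

Definition tensor_kernel (u v : R -> R[i]) (z : R * R) : R[i] :=
  u z.1 * conjc (v z.2).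

Lemma inL2_tensor_kernel (u v : R -> R[i]) : inL2 mu u -> inL2 mu v ->
  inL2 mu2 (tensor_kernel u v).
Proof.
move=> [mu_ u2] [mv v2].
have mT : cmeasurable (tensor_kernel u v).
  apply: cmeasurableM; first exact: cmeasurable_comp mu_ measurable_fst.
  by apply: cmeasurableJ; exact: cmeasurable_comp mv measurable_snd.
split => //; have mT2 := measurable_normc_sqE mT.
have T0 (z : R * R) : (0 <= (Normc.normc (tensor_kernel u v z) ^+ 2)%:E)%E.
  by rewrite lee_fin sqr_ge0.
have V0 := L2normsq_ge0 mu setT v; have U0 := L2normsq_ge0 mu setT u.
rewrite [ltLHS](fubini_tonelli1 (m1 := mu) (m2 := mu) _ mT2 T0) /fubini_F.
have E t : (\int[mu]_s (Normc.normc (tensor_kernel u v (t, s)) ^+ 2)%:E =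
    (Normc.normc (u t) ^+ 2)%:E * L2normsq mu setT v)%E.
  rewrite /L2normsq -ge0_integralZl//.
  - by apply: eq_integral => s _; rewrite normc_sqM normc_sqJ EFinM.
  - exact: measurable_normc_sqE.
  - by move=> x _; rewrite lee_fin sqr_ge0.
  - by rewrite lee_fin sqr_ge0.
under eq_integral do rewrite E.
rewrite ge0_integralZr//.
- by rewrite lte_mul_pinfty// ge0_fin_numE.
- exact: measurable_normc_sqE.
- by move=> x _; rewrite lee_fin sqr_ge0.
Qed.

Lemma cintegrable_diagonal_tensor (u v : R -> R[i]) b : inL2 mu u -> inL2 mu v ->
  cintegrable mu setT (diagonal (tensor_kernel u v) b).
Proof.
by move=> u2 v2; apply: cintegrableM => //; apply: inL2J; exact: inL2_translate.
Qed.

(** After the substitution of [t + a] for [t], the phases of the modulations combine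
into a character: this is the covariance of the cross-ambiguity function. *)
Lemma fourier_diagonal_gabor (g h : R -> R[i]) (a w b nu : R) :
  inL2 mu g -> inL2 mu h ->
  fourier (diagonal (tensor_kernel (tfshift a w h) (tfshift a w g)) b) nu =
  e2ipi (w * b - a * nu) * stft g h (b, nu).
Proof.
move=> g2 h2; rewrite /fourier /stft /inner.
have i1 : cintegrable mu setT (fun t => h t * conjc (tfshift b nu g t)).
  by apply: cintegrable_inner => //; exact: inL2_tfshift.
rewrite -cintegralZ//.
have m1 : cmeasurable (fun t => e2ipi (w * b - a * nu) *
    (h t * conjc (tfshift b nu g t))).
  apply: cmeasurableM; first exact: cmeasurable_cst.
  apply: cmeasurableM; first by case: h2.
  by apply: cmeasurableJ; have [] := inL2_tfshift b nu g2.
rewrite -(cintegral_translate (- a) m1); apply: cintegral_eq => t _.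
rewrite /diagonal /tensor_kernel /tfshift /modulation /translation.
cbn [fst snd]; rewrite !conjcM -!e2ipiN.
rewrite (_ : t - a - b = t - b - a); last by ring.
set x := conjc _; set y := h _.
rewrite (_ : w * b - a * nu = w * t + (- (w * (t - b))) + - (nu * t) + nu * (t - a));
  last by ring.
rewrite !e2ipiD !e2ipiN.
set A := e2ipi (w * t); set B := e2ipi (w * _); set C := e2ipi (nu * t).
set D := e2ipi (nu * _).
have D1 : D * conjc D = 1 by rewrite mulrJ_normc_sq normc_sq_e2ipi.
move: (conjc B) (conjc C) (conjc D) D1 => B' C' D' D1.
move: x y A D D1 => x y A D D1.
have -> : A * B' * C' * D * (y * (D' * x)) = A * B' * C' * (D * D') * (y * x).
  by ring.
by rewrite D1; ring.
Qed.

Lemma cmeasurable_stft (g h : R -> R[i]) : inL2 mu g -> inL2 mu h ->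
  cmeasurable (stft g h).
Proof.
move=> [mg _] [mh _].
have m : cmeasurable (fun z : (R * R) * R =>
    h z.2 * conjc (tfshift z.1.1 z.1.2 g z.2)).
  have m11 : measurable_fun setT (fun z : (R * R) * R => z.1.1).
    exact: measurableT_comp measurable_fst measurable_fst.
  have m12 : measurable_fun setT (fun z : (R * R) * R => z.1.2).
    exact: measurableT_comp measurable_snd measurable_fst.
  apply: cmeasurableM; first exact: cmeasurable_comp mh measurable_snd.
  apply: cmeasurableJ; apply: cmeasurableM.
    by apply: cmeasurable_e2ipi; apply: measurable_funM.
  by apply: (cmeasurable_comp mg); apply: measurable_funB.
exact: (cmeasurable_parameter_cintegral mu measurableT m).
Qed.

End GaborKernel.

Section GaborPartialSums.
Context (R : realType).
Local Notation mu := (@lebesgue_measure R).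
Local Notation mu2 := (mu \x mu)%E.
Variables (g h : R -> R[i]) (b0 nu0 : R) (m : int -> int -> R[i]).
Hypotheses (g2 : inL2 mu g) (h2 : inL2 mu h).

(** The kernel of the [N]-th partial sum of the Gabor multiplier. *)
Definition gabor_kernel (N : nat) (z : R * R) : R[i] :=
  square_sum (fun k l => m k l *
    tensor_kernel (tfshift (k%:~R * b0) (l%:~R * nu0) h)
                  (tfshift (k%:~R * b0) (l%:~R * nu0) g) z) N.

(** The [N]-th partial sum of the symplectic Fourier series of [m]. *)
Definition gabor_symbol (N : nat) (x : R * R) : R[i] :=
  square_sum (fun k l =>
    m k l * e2ipi (l%:~R * nu0 * x.1 - k%:~R * b0 * x.2)) N.

Let g2' a w : inL2 mu (tfshift a w g). Proof. exact: inL2_tfshift. Qed.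
Let h2' a w : inL2 mu (tfshift a w h). Proof. exact: inL2_tfshift. Qed.

Lemma inL2_gabor_kernel N : inL2 mu2 (gabor_kernel N).
Proof.
apply: inL2_sum => i; apply: inL2_sum => j.
by apply: inL2Z; exact: inL2_tensor_kernel.
Qed.

Let cintegral_square_sum (F : int -> int -> R -> R[i]) N :
  (forall k l, cintegrable mu setT (F k l)) ->
  cintegrable mu setT (fun t => square_sum (fun k l => F k l t) N) /\
  cintegral mu setT (fun t => square_sum (fun k l => F k l t) N) =
  square_sum (fun k l => cintegral mu setT (F k l)) N.
Proof.
move=> iF.
have h1 (i : 'I_(2 * N).+1) := cintegral_sum (index_enum 'I_(2 * N).+1) measurableT
  (fun j : 'I_(2 * N).+1 => iF (i%:Z - N%:Z) (j%:Z - N%:Z)).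
have [I1 I2] := cintegral_sum (index_enum 'I_(2 * N).+1) measurableT
  (fun i => (h1 i).1).
by split => //; rewrite [LHS]I2; apply: eq_bigr => i _; exact: (h1 i).2.
Qed.

Lemma cintegrable_diagonal_gabor N b :
  cintegrable mu setT (diagonal (gabor_kernel N) b).
Proof.
pose F (k l : int) (t : R) := m k l * diagonal
  (tensor_kernel (tfshift (k%:~R * b0) (l%:~R * nu0) h)
                  (tfshift (k%:~R * b0) (l%:~R * nu0) g)) b t.
have iF k l : cintegrable mu setT (F k l).
  by apply: cintegrableZ => //; exact: cintegrable_diagonal_tensor.
exact: (cintegral_square_sum N iF).1.
Qed.

(** Summed over the lattice, the characters of [fourier_diagonal_gabor] form the
symplectic Fourier series of [m]. *)
Lemma fourier_diagonal_gabor_kernel N x :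
  fourier (diagonal (gabor_kernel N) x.1) x.2 = gabor_symbol N x * stft g h x.
Proof.
pose D k l := diagonal
  (tensor_kernel (tfshift (k%:~R * b0) (l%:~R * nu0) h)
                  (tfshift (k%:~R * b0) (l%:~R * nu0) g)) x.1.
have iD k l : cintegrable mu setT (fun t => D k l t * e2ipi (- (x.2 * t))).
  by apply: cintegrable_modulation; exact: cintegrable_diagonal_tensor.
pose F k l t := m k l * (D k l t * e2ipi (- (x.2 * t))).
have iF k l : cintegrable mu setT (F k l) by exact: cintegrableZ.
have E := (cintegral_square_sum N iF).2.
have -> : fourier (diagonal (gabor_kernel N) x.1) x.2 =
    cintegral mu setT (fun t => square_sum (fun k l => F k l t) N).
  apply: cintegral_eq => t _; rewrite /diagonal /gabor_kernel /square_sum.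
  rewrite mulr_suml; apply: eq_bigr => i _; rewrite mulr_suml.
  by apply: eq_bigr => j _; rewrite /F mulrA.
rewrite E /gabor_symbol /square_sum mulr_suml; apply: eq_bigr => i _.
rewrite mulr_suml; apply: eq_bigr => j _; rewrite cintegralZ// -mulrA.
congr (_ * _); have := fourier_diagonal_gabor ((i%:Z - N%:Z)%:~R * b0)
  ((j%:Z - N%:Z)%:~R * nu0) x.1 x.2 g2 h2.
by rewrite -surjective_pairing.
Qed.

Lemma cmeasurable_gabor_symbol N : cmeasurable (gabor_symbol N).
Proof.
apply: cmeasurable_sum => i; apply: cmeasurable_sum => j.
apply: cmeasurableM; first exact: cmeasurable_cst.
by apply: cmeasurable_e2ipi; apply: measurable_funB; apply: measurable_funM.
Qed.

(** A shift by the adjoint lattice changes every phase by an integer. *)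
Lemma gabor_symbol_adjshift N x k l : 0 < b0 -> 0 < nu0 ->
  gabor_symbol N (adjshift b0 nu0 x k l) = gabor_symbol N x.
Proof.
move=> b00 nu00; apply: eq_bigr => i _; apply: eq_bigr => j _; congr (_ * _).
rewrite /adjshift; cbn [fst snd].
move: (i%:Z - N%:Z) (j%:Z - N%:Z) => p q.
rewrite (_ : q%:~R * nu0 * _ - _ = (q%:~R * nu0 * x.1 - p%:~R * b0 * x.2) +
    (q * k - p * l)%:~R :> R).
  by rewrite e2ipiD e2ipi_int mulr1.
by rewrite intrD mulrNz !intrM; field; rewrite !gt_eqF.
Qed.

Lemma gabor_partial_sumE N f t : inL2 mu f ->
  square_sum (fun k l => m k l * stft g f (k%:~R * b0, l%:~R * nu0) *
    tfshift (k%:~R * b0) (l%:~R * nu0) h t) N =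
  cintegral mu setT (fun s => gabor_kernel N (t, s) * f s).
Proof.
move=> f2.
pose F k l s := (m k l * tfshift (k%:~R * b0) (l%:~R * nu0) h t) *
  (f s * conjc (tfshift (k%:~R * b0) (l%:~R * nu0) g s)).
have ifg k l : cintegrable mu setT
    (fun s => f s * conjc (tfshift (k%:~R * b0) (l%:~R * nu0) g s)).
  exact: cintegrable_inner.
have iF k l : cintegrable mu setT (F k l) by exact: cintegrableZ.
have E := (cintegral_square_sum N iF).2.
have -> : cintegral mu setT (fun s => gabor_kernel N (t, s) * f s) =
    cintegral mu setT (fun s => square_sum (fun k l => F k l s) N).
  apply: cintegral_eq => s _; rewrite /gabor_kernel /square_sum.
  rewrite mulr_suml; apply: eq_bigr => i _; rewrite mulr_suml.
  by apply: eq_bigr => j _; rewrite /F /tensor_kernel; cbn [fst snd]; ring.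
rewrite E; apply: eq_bigr => i _; apply: eq_bigr => j _.
by rewrite cintegralZ// /stft /inner; cbn [fst snd]; ring.
Qed.

Lemma inL2_gabor_partial_sum N f : inL2 mu (fun t =>
  square_sum (fun k l => m k l * stft g f (k%:~R * b0, l%:~R * nu0) *
    tfshift (k%:~R * b0) (l%:~R * nu0) h t) N).
Proof.
by apply: inL2_sum => i; apply: inL2_sum => j; exact: inL2Z.
Qed.

End GaborPartialSums.

(** * Periodization over the adjoint lattice *)

(** Enumerating Z^2 reduces the sums over Z^2 to series, and countable unions over
Z^2 to countable unions over the natural numbers. *)
Lemma enum_int2 : exists s : nat -> int * int, set_bij setT setT s.
Proof.
have inf : infinite_set [set: int * int].
  move=> /(finite_image (fun z : int * int => `|z.1|%N)).
  rewrite (_ : _ @` _ = [set: nat]); first exact: infinite_nat.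
  by apply/seteqP; split => // n _; exists (n%:Z, 0).
have /card_set_bijP[f [_ finj fsurj]] : ([set: int * int] #= [set: nat])%card.
  by apply/card_eqPle; split; [exact: countableP|exact/infiniteP].
have fs n : exists p, f p = n by have [p _ <-] := fsurj n I; exists p.
exists (fun n => sval (cid (fs n))).
have sK n : f (sval (cid (fs n))) = n by exact: (svalP (cid (fs n))).
split => //.
- by move=> i j _ _ ij; rewrite -(sK i) -(sK j) ij.
- by move=> p _; exists (f p) => //; apply: finj; rewrite ?inE// sK.
Qed.

Section Periodization.
Context (R : realType).
Local Notation mu := (@lebesgue_measure R).
Local Notation mu2 := (mu \x mu)%E.
Variables (b0 nu0 : R).
Hypotheses (b00 : 0 < b0) (nu00 : 0 < nu0).

Lemma measurable_cell :
  measurable (cell b0 nu0 : set (measurableTypeR R * measurableTypeR R)).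
Proof. by apply: measurableX; exact: measurable_itv. Qed.

Lemma measurable_shift2 (a c : R) :
  measurable_fun setT (fun z : R * R => (z.1 + a, z.2 + c)).
Proof. by apply: measurable_fun_pair; apply: measurable_funD. Qed.

Lemma measurable_adjshift k l :
  measurable_fun setT (fun z : R * R => adjshift b0 nu0 z k l).
Proof. exact: measurable_shift2. Qed.

Lemma ge0_integral_shift2 (F : R * R -> \bar R) (a c : R) :
  measurable_fun setT F -> (forall z, 0 <= F z)%E ->
  (\int[mu2]_z F (z.1 + a, z.2 + c)%R = \int[mu2]_z F z)%E.
Proof.
move=> mF F0.
have mFs : measurable_fun setT (fun z : R * R => F (z.1 + a, z.2 + c)).
  exact: measurableT_comp mF (measurable_shift2 a c).
have Fs0 (z : R * R) : (0 <= F (z.1 + a, z.2 + c)%R)%E by exact: F0.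
rewrite [LHS](fubini_tonelli1 (m1 := mu) (m2 := mu) _ mFs Fs0).
rewrite [RHS](fubini_tonelli1 (m1 := mu) (m2 := mu) _ mF F0).
have mG := @measurable_fun_fubini_tonelli_F _ _ _ _ R mu _ mF F0.
have G0 x : (0 <= fubini_F mu F x)%E by exact: integral_ge0.
rewrite -[RHS](ge0_integral_translate a mG G0).
apply: eq_integral => x _; rewrite /fubini_F; cbn [fst snd].
apply: (ge0_integral_translate (f := fun y => F (x + a, y))) => //.
exact: (measurableT_comp mF (pair1_measurable (x + a))).
Qed.

Lemma cell_floor (x : R * R) k l : cell b0 nu0 (adjshift b0 nu0 x (- k) (- l)) <->
  Num.floor (x.1 * nu0) = k /\ Num.floor (x.2 * b0) = l.
Proof.
have H (y p : R) (n : int) : 0 < p ->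
    [set` `[0%R, p^-1[%R] (y + (- n)%:~R / p) <-> Num.floor (y * p) = n.
  move=> p0; rewrite /= in_itv/= mulrNz mulNr subr_ge0 ltrBlDr.
  rewrite ler_pdivrMr// -[X in X + _]mul1r -mulrDl ltr_pdivlMr//.
  by rewrite addrC -(intrD _ n 1) -floor_eq; split=> /eqP.
rewrite /cell /adjshift; split.
  by move=> [/(H _ _ _ nu00) h1 /(H _ _ _ b00) h2].
by move=> [/(H _ _ _ nu00) h1 /(H _ _ _ b00) h2].
Qed.

Lemma adjshiftK (x : R * R) k l :
  adjshift b0 nu0 (adjshift b0 nu0 x k l) (- k) (- l) = x.
Proof.
by case: x => x y; rewrite /adjshift /= !mulrNz !mulNr !addrK.
Qed.

(** The plane is tiled by the translates of the cell, and each of them is brought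
back to the cell by a translation. *)
Lemma integral_periodize (F : R * R -> \bar R) :
  measurable_fun setT F -> (forall z, 0 <= F z)%E ->
  (\int[mu2]_z F z = \int[mu2]_(x in cell b0 nu0)
     \esum_(p in [set: int * int]) F (adjshift b0 nu0 x p.1 p.2))%E.
Proof.
move=> mF F0; have [s sbij] := enum_int2.
pose C n : set (R * R) :=
  (fun z => adjshift b0 nu0 z (- (s n).1) (- (s n).2)) @^-1` cell b0 nu0.
have mC n : measurable (C n).
  rewrite -[C n]setTI; apply: measurable_adjshift => //; exact: measurable_cell.
have cover : \bigcup_n C n = setT.
  apply/seteqP; split => // z _.
  have [_ _ /(_ (Num.floor (z.1 * nu0), Num.floor (z.2 * b0)) I) [n _ sn]] := sbij.
  by exists n => //; apply/cell_floor; rewrite sn.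
have triv : trivIset setT C.
  apply/trivIsetP => i j _ _ ij; apply/seteqP; split => // z [].
  move=> /cell_floor[i1 i2] /cell_floor[j1 j2]; apply: (negP ij); apply/eqP.
  have [_ inj _] := sbij; apply: inj; rewrite ?inE//.
  by rewrite [s i]surjective_pairing [s j]surjective_pairing -i1 -i2 -j1 -j2.
have piece n : (\int[mu2]_(z in C n) F z =
    \int[mu2]_(x in cell b0 nu0) F (adjshift b0 nu0 x (s n).1 (s n).2))%E.
  rewrite integral_mkcond [RHS]integral_mkcond.
  have mFC : measurable_fun setT (F \_ (C n)).
    by apply/(measurable_restrictT _ _).1 => //; exact: measurable_funTS.
  have FC0 z : (0 <= (F \_ (C n)) z)%E by rewrite patchE; case: ifP.
  rewrite -(ge0_integral_shift2 ((s n).1%:~R / nu0) ((s n).2%:~R / b0) mFC FC0).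
  apply: eq_integral => x _; rewrite !patchE.
  have -> // : ((x.1 + (s n).1%:~R / nu0, x.2 + (s n).2%:~R / b0) \in C n) =
      (x \in cell b0 nu0).
  by apply/idP/idP; rewrite !inE /C /preimage -[(_, _)]/(adjshift b0 nu0 x _ _) /=
    adjshiftK.
rewrite -{1}cover ge0_integral_bigcup//; last first.
  by rewrite cover.
under eq_eseriesr do rewrite piece.
have mFs n : measurable_fun (cell b0 nu0)
    (fun x => F (adjshift b0 nu0 x (s n).1 (s n).2)).
  apply: measurable_funTS; exact: measurableT_comp mF (measurable_adjshift _ _).
rewrite -integral_nneseries//; last exact: measurable_cell.
apply: eq_integral => x _.
rewrite (@reindex_esum _ _ _ setT setT s _ sbij).
by rewrite nneseries_esumT.
Qed.

End Periodization.

(** * Sums over Z^2 and projection on a line *)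

Section SumsZ2.
Context (R : realType).
Implicit Types F G : int -> int -> R.

Lemma nnsumZ2_series (s : nat -> int * int) F : set_bij setT setT s ->
  (forall k l, 0 <= F k l) ->
  nnsumZ2 F = (\sum_(0 <= n <oo) (F (s n).1 (s n).2)%:E)%E.
Proof.
move=> sbij F0; rewrite /nnsumZ2 (@reindex_esum _ _ _ setT setT s _ sbij).
by rewrite nneseries_esumT// => n; rewrite lee_fin.
Qed.

Lemma nnsumZ2_ge0 F : (forall k l, 0 <= F k l) -> (0 <= nnsumZ2 F)%E.
Proof. by move=> F0; apply: esum_ge0 => p _; rewrite lee_fin. Qed.

Lemma le_nnsumZ2 F G : (forall k l, F k l <= G k l) -> (nnsumZ2 F <= nnsumZ2 G)%E.
Proof. by move=> FG; apply: le_esum => p _; rewrite lee_fin. Qed.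

Lemma nnsumZ2D F G : (forall k l, 0 <= F k l) -> (forall k l, 0 <= G k l) ->
  nnsumZ2 (fun k l => F k l + G k l) = (nnsumZ2 F + nnsumZ2 G)%E.
Proof.
move=> F0 G0; rewrite /nnsumZ2 -esumD; first by apply: eq_esum.
- by move=> p _; rewrite lee_fin.
- by move=> p _; rewrite lee_fin.
Qed.

Lemma nnsumZ2Z (c : R) F : 0 <= c -> (forall k l, 0 <= F k l) ->
  nnsumZ2 (fun k l => c * F k l) = (c%:E * nnsumZ2 F)%E.
Proof.
move=> c0 F0; have [s sbij] := enum_int2.
rewrite (nnsumZ2_series sbij) ?(nnsumZ2_series sbij F0); last first.
  by move=> k l; rewrite mulr_ge0.
rewrite -nneseriesZl//.
by move=> n _; rewrite lee_fin.
Qed.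

Definition summableZ2 F := (nnsumZ2 (fun k l => `|F k l|%R) < +oo)%E.

Lemma summableZ2_le F G : (forall k l, `|F k l| <= G k l) ->
  (nnsumZ2 G < +oo)%E -> summableZ2 F.
Proof. by move=> FG; apply: le_lt_trans; exact: le_nnsumZ2. Qed.

Lemma summableZ2D F G : summableZ2 F -> summableZ2 G ->
  summableZ2 (fun k l => F k l + G k l).
Proof.
move=> sF sG.
apply: (@summableZ2_le _ (fun k l => `|F k l| + `|G k l|)).
  by move=> k l; exact: ler_normD.
by rewrite nnsumZ2D//; exact: lte_add_pinfty.
Qed.

Lemma summableZ2Z c F : summableZ2 F -> summableZ2 (fun k l => c * F k l).
Proof.
move=> sF; apply: (@summableZ2_le _ (fun k l => `|c| * `|F k l|)).
  by move=> k l; rewrite normrM.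
by rewrite nnsumZ2Z// lte_mul_pinfty// lee_fin.
Qed.

(** The sum does not depend on the way a family is written as a difference of
nonnegative summable families. *)
Lemma rsumZ2B (f g : int -> int -> R) F :
  (forall k l, 0 <= f k l) -> (forall k l, 0 <= g k l) ->
  (nnsumZ2 f < +oo)%E -> (nnsumZ2 g < +oo)%E ->
  (forall k l, F k l = f k l - g k l) ->
  rsumZ2 F = fine (nnsumZ2 f) - fine (nnsumZ2 g).
Proof.
move=> f0 g0 sf sg FE.
pose p k l := Num.max (F k l) 0; pose n k l := Num.max (- F k l) 0.
have p0 k l : 0 <= p k l by rewrite le_max lexx orbT.
have n0 k l : 0 <= n k l by rewrite le_max lexx orbT.
have sp : (nnsumZ2 p < +oo)%E.
  apply: le_lt_trans sf; apply: le_nnsumZ2 => k l.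
  by rewrite ge_max f0 FE andbT gerBl.
have sn : (nnsumZ2 n < +oo)%E.
  apply: le_lt_trans sg; apply: le_nnsumZ2 => k l.
  by rewrite ge_max g0 FE andbT opprB gerBl.
have E : (nnsumZ2 p + nnsumZ2 g = nnsumZ2 f + nnsumZ2 n)%E.
  rewrite -!nnsumZ2D//; congr nnsumZ2; apply/funext => k; apply/funext => l.
  rewrite /p /n; have := FE k l; have [F0|F0] := leP 0 (F k l).
    by rewrite (max_idPr _) ?oppr_le0//; lra.
  by rewrite (max_idPl _) ?oppr_ge0 ?ltW//; lra.
have fin (u : int -> int -> R) : (forall k l, 0 <= u k l) ->
    (nnsumZ2 u < +oo)%E -> nnsumZ2 u \is a fin_num.
  by move=> u0 su; rewrite ge0_fin_numE// nnsumZ2_ge0.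
have := congr1 fine E; rewrite !fineD ?fin// /rsumZ2 -/p -/n.
by rewrite -[nnsumZ2 (fun k l => Num.max (F k l) 0)]/(nnsumZ2 p)
  -[nnsumZ2 (fun k l => Num.max (- F k l) 0)]/(nnsumZ2 n); lra.
Qed.

Let pos F k l := Num.max (F k l) 0.
Let neg F k l := Num.max (- F k l) 0.

Let pos_ge0 F k l : 0 <= pos F k l. Proof. by rewrite le_max lexx orbT. Qed.
Let neg_ge0 F k l : 0 <= neg F k l. Proof. by rewrite le_max lexx orbT. Qed.

Let posnegE F k l : F k l = pos F k l - neg F k l.
Proof.
rewrite /pos /neg; have [F0|F0] := leP 0 (F k l).
  by rewrite (max_idPr _) ?oppr_le0// subr0.
by rewrite (max_idPl _) ?oppr_ge0 ?ltW// sub0r opprK.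
Qed.

Let sum_pos F : summableZ2 F -> (nnsumZ2 (pos F) < +oo)%E.
Proof.
by apply: le_lt_trans; apply: le_nnsumZ2 => k l; rewrite ge_max ler_norm normr_ge0.
Qed.

Let sum_neg F : summableZ2 F -> (nnsumZ2 (neg F) < +oo)%E.
Proof.
apply: le_lt_trans; apply: le_nnsumZ2 => k l.
by rewrite ge_max -normrN ler_norm normr_ge0.
Qed.

Let sum_fin (u : int -> int -> R) : (forall k l, 0 <= u k l) ->
    (nnsumZ2 u < +oo)%E -> nnsumZ2 u \is a fin_num.
Proof. by move=> u0 su; rewrite ge0_fin_numE// nnsumZ2_ge0. Qed.

Lemma rsumZ2D F G : summableZ2 F -> summableZ2 G ->
  rsumZ2 (fun k l => F k l + G k l) = rsumZ2 F + rsumZ2 G.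
Proof.
move=> sF sG.
have sp := nnsumZ2D (pos_ge0 F) (pos_ge0 G).
have sn := nnsumZ2D (neg_ge0 F) (neg_ge0 G).
rewrite (@rsumZ2B (fun k l => pos F k l + pos G k l)
    (fun k l => neg F k l + neg G k l)).
- have fpF := sum_fin (pos_ge0 F) (sum_pos sF).
  have fpG := sum_fin (pos_ge0 G) (sum_pos sG).
  have fnF := sum_fin (neg_ge0 F) (sum_neg sF).
  have fnG := sum_fin (neg_ge0 G) (sum_neg sG).
  by rewrite sp sn !fineD// /rsumZ2; ring.
- by move=> k l; rewrite addr_ge0.
- by move=> k l; rewrite addr_ge0.
- by rewrite sp; apply: lte_add_pinfty; exact: sum_pos.
- by rewrite sn; apply: lte_add_pinfty; exact: sum_neg.
- by move=> k l; rewrite {1}(posnegE F) {1}(posnegE G); ring.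
Qed.

Lemma rsumZ2Z c F : summableZ2 F -> rsumZ2 (fun k l => c * F k l) = c * rsumZ2 F.
Proof.
move=> sF; have sp := sum_pos sF; have sn := sum_neg sF.
have Zlt (d : R) (u : int -> int -> R) : 0 <= d -> (forall k l, 0 <= u k l) -> (nnsumZ2 u < +oo)%E ->
    (nnsumZ2 (fun k l => d * u k l)%R < +oo)%E.
  by move=> d0 u0 su; rewrite nnsumZ2Z// lte_mul_pinfty// lee_fin.
have [c0|c0] := leP 0 c.
  rewrite (@rsumZ2B (fun k l => c * pos F k l) (fun k l => c * neg F k l)).
  - by rewrite !nnsumZ2Z// !fineM ?sum_fin// /rsumZ2 mulrBr.
  - by move=> k l; rewrite mulr_ge0.
  - by move=> k l; rewrite mulr_ge0.
  - exact: Zlt.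
  - exact: Zlt.
  - by move=> k l; rewrite {1}(posnegE F) mulrBr.
have d0 : 0 <= - c by rewrite oppr_ge0 ltW.
rewrite (@rsumZ2B (fun k l => - c * neg F k l) (fun k l => - c * pos F k l)).
- by rewrite !nnsumZ2Z// !fineM ?sum_fin// /rsumZ2 !mulNr opprK -mulrN addrC -mulrDr.
- by move=> k l; rewrite mulr_ge0.
- by move=> k l; rewrite mulr_ge0.
- exact: Zlt.
- exact: Zlt.
- by move=> k l; rewrite {1}(posnegE F); ring.
Qed.

Lemma rsumZ2_ge0E F : (forall k l, 0 <= F k l) -> (nnsumZ2 F < +oo)%E ->
  nnsumZ2 F = (rsumZ2 F)%:E.
Proof.
move=> F0 sF; have z : nnsumZ2 (fun _ _ : int => 0 : R) = 0%E by exact: esum1.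
rewrite (@rsumZ2B F (fun _ _ => 0)) ?z//= ?subr0 ?fineK ?sum_fin//.
by move=> k l; rewrite subr0.
Qed.

End SumsZ2.

Section PointwiseOptimum.
Context (R : realType).
Implicit Types a v : int -> int -> R[i].

(** The coefficient [M] is that of the orthogonal projection of [a] on the line
spanned by [v] in the square-summable families, so the squared distance is given
by Pythagoras' theorem. *)
Lemma nnsumZ2_projection a v (P M : R[i]) :
  (nnsumZ2 (fun k l => Normc.normc (a k l) ^+ 2)%R < +oo)%E ->
  (nnsumZ2 (fun k l => Normc.normc (v k l) ^+ 2)%R < +oo)%E ->
  0 < fine (nnsumZ2 (fun k l => Normc.normc (v k l) ^+ 2)) ->
  P = csumZ2 (fun k l => a k l * conjc (v k l)) ->
  M = ((fine (nnsumZ2 (fun k l => Normc.normc (v k l) ^+ 2)))^-1)%:C%C * P ->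
  nnsumZ2 (fun k l => Normc.normc (a k l - M * v k l) ^+ 2) =
  (fine (nnsumZ2 (fun k l => Normc.normc (a k l) ^+ 2)) - Normc.normc P ^+ 2 /
   fine (nnsumZ2 (fun k l => Normc.normc (v k l) ^+ 2)))%:E.
Proof.
set S := nnsumZ2 _; set U := nnsumZ2 _ => Sfin Ufin U0 PE ME.
pose A k l := Normc.normc (a k l) ^+ 2; pose V k l := Normc.normc (v k l) ^+ 2.
pose X k l := complex.Re (a k l * conjc (v k l)).
pose Y k l := complex.Im (a k l * conjc (v k l)).
have A0 k l : 0 <= A k l by exact: sqr_ge0.
have V0 k l : 0 <= V k l by exact: sqr_ge0.
have sA : summableZ2 A by apply: (@summableZ2_le _ _ A) => // k l; rewrite ger0_norm.
have sV : summableZ2 V by apply: (@summableZ2_le _ _ V) => // k l; rewrite ger0_norm.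
have AV : (nnsumZ2 (fun k l => A k l + V k l)%R < +oo)%E.
  by rewrite nnsumZ2D//; exact: lte_add_pinfty.
have sX : summableZ2 X.
  apply: summableZ2_le AV => k l; rewrite /X /A /V ReM ReJ ImJ !normc_sq.
  have := norm_det_le (complex.Re (a k l)) (complex.Im (a k l))
    (complex.Re (v k l)) (- complex.Im (v k l)).
  by rewrite sqrrN.
have sY : summableZ2 Y.
  apply: summableZ2_le AV => k l; rewrite /Y /A /V ImM ReJ ImJ !normc_sq.
  have := norm_det_le (complex.Re (a k l)) (- complex.Im (a k l))
    (- complex.Im (v k l)) (complex.Re (v k l)).
  by rewrite !sqrrN mulNr opprK (addrC (complex.Im (v k l) ^+ 2)).
have SE : fine S = rsumZ2 A by rewrite /S (rsumZ2_ge0E A0 Sfin).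
have UE : fine U = rsumZ2 V by rewrite /U (rsumZ2_ge0E V0 Ufin).
(* The expansion of the square; each term is a multiple of a summable family. *)
pose q k l := A k l + ((Normc.normc M ^+ 2) * V k l +
  ((- 2 * complex.Re M) * X k l + (- 2 * complex.Im M) * Y k l)).
have qE k l : Normc.normc (a k l - M * v k l) ^+ 2 = q k l.
  by rewrite /q /A /V /X /Y !normc_sq !ReImE; ring.
have sMV := summableZ2Z (Normc.normc M ^+ 2) sV.
have sMX := summableZ2Z (- 2 * complex.Re M) sX.
have sMY := summableZ2Z (- 2 * complex.Im M) sY.
have sXY := summableZ2D sMX sMY.
have sVXY := summableZ2D sMV sXY.
have sq : summableZ2 q := summableZ2D sA sVXY.
have q0 k l : 0 <= q k l by rewrite -qE sqr_ge0.
have qfin : (nnsumZ2 q < +oo)%E.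
  by apply: le_lt_trans sq; apply: le_nnsumZ2 => k l; exact: ler_norm.
rewrite (_ : (fun k l => Normc.normc (a k l - M * v k l) ^+ 2) = q); last first.
  by apply/funext => k; apply/funext => l.
rewrite (rsumZ2_ge0E q0 qfin); congr (_%:E); rewrite /q.
rewrite (rsumZ2D sA sVXY) (rsumZ2D sMV sXY) (rsumZ2D sMX sMY).
rewrite (rsumZ2Z _ sV) (rsumZ2Z _ sX) (rsumZ2Z _ sY) -SE -UE.
have -> : rsumZ2 X = complex.Re P by rewrite PE.
have -> : rsumZ2 Y = complex.Im P by rewrite PE.
rewrite ME normc_sqM !normc_sq !ReImE /=.
by move: (fine U) U0 => u u0; field; rewrite gt_eqF.
Qed.

End PointwiseOptimum.

(** * Residual on the cell *)

Section PeriodizedMeasurability.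
Context (R : realType).
Local Notation mu := (@lebesgue_measure R).
Local Notation mu2 := (mu \x mu)%E.

Lemma measurable_nnsumZ2 d (T : measurableType d) (F : T -> int -> int -> R) :
  (forall x k l, 0 <= F x k l) -> (forall k l, measurable_fun setT (F ^~ k ^~ l)) ->
  measurable_fun setT (fun x => nnsumZ2 (F x)).
Proof.
move=> F0 mF; have [s sbij] := enum_int2.
under eq_fun do rewrite (nnsumZ2_series sbij)//.
apply: ge0_emeasurable_sum => [n x _ _|n _]; first by rewrite lee_fin.
by apply/measurable_EFinP; exact: mF.
Qed.

Lemma measurable_rsumZ2 d (T : measurableType d) (F : T -> int -> int -> R) :
  (forall k l, measurable_fun setT (F ^~ k ^~ l)) ->
  measurable_fun setT (fun x => rsumZ2 (F x)).
Proof.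
move=> mF; apply: measurable_funB.
- apply: (measurableT_comp (fine_measurable measurableT)).
  apply: (measurable_nnsumZ2 (F := fun x k l => Num.max (F x k l) 0)) => [x k l|k l].
    by rewrite le_max lexx orbT.
  by apply: measurable_maxr => //; exact: mF.
- apply: (measurableT_comp (fine_measurable measurableT)).
  apply: (measurable_nnsumZ2 (F := fun x k l => Num.max (- F x k l) 0)) => [x k l|k l].
    by rewrite le_max lexx orbT.
  by apply: measurable_maxr => //; apply: measurableT_comp => //; exact: mF.
Qed.

Variables (b0 nu0 : R).

Lemma cmeasurable_adjshift (F : R * R -> R[i]) k l : cmeasurable F ->
  cmeasurable (fun x => F (adjshift b0 nu0 x k l)).
Proof. by move=> mF; exact: cmeasurable_comp mF (measurable_adjshift _ _ _ _). Qed.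

Lemma measurable_periodized_normsq (F : R * R -> R[i]) : cmeasurable F ->
  measurable_fun setT (periodized_normsq b0 nu0 F).
Proof.
move=> mF; apply: (measurable_nnsumZ2
  (F := fun x k l => Normc.normc (F (adjshift b0 nu0 x k l)) ^+ 2)) => [x k l|k l].
  exact: sqr_ge0.
by apply: measurable_normc_sq; exact: cmeasurable_adjshift.
Qed.

Lemma periodized_normsq_ge0 (F : R * R -> R[i]) x :
  (0 <= periodized_normsq b0 nu0 F x)%E.
Proof. by apply: nnsumZ2_ge0 => k l; exact: sqr_ge0. Qed.

Lemma L2normsq_periodize (F : R * R -> R[i]) : 0 < b0 -> 0 < nu0 -> cmeasurable F ->
  L2normsq mu2 setT F =
  (\int[mu2]_(x in cell b0 nu0) periodized_normsq b0 nu0 F x)%E.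
Proof.
move=> b00 nu00 mF; rewrite /L2normsq.
rewrite (integral_periodize b00 nu00 (measurable_normc_sqE mF))//.
by move=> z; rewrite lee_fin sqr_ge0.
Qed.

Lemma cmeasurable_best_transfer (V eta : R * R -> R[i]) : cmeasurable V ->
  cmeasurable eta -> cmeasurable (best_transfer b0 nu0 V eta).
Proof.
move=> mV meta; apply: cmeasurableM.
  split; last exact: measurable_cst.
  (* The inverse is a real power, also at 0, where both are 0. *)
  rewrite (_ : (fun _ => _) =
      (fun x => (fine (periodized_normsq b0 nu0 V x)) `^ (-1))).
    have mU := measurable_periodized_normsq mV.
    have mfU := measurableT_comp (fine_measurable measurableT) mU.
    exact: measurableT_comp (measurable_powR (-1)) mfU.
  by apply/funext => x; rewrite powR_inv1// fine_ge0// periodized_normsq_ge0.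
have m k l : cmeasurable (fun x => eta (adjshift b0 nu0 x k l) *
    conjc (V (adjshift b0 nu0 x k l))).
  by apply: cmeasurableM; [|apply: cmeasurableJ]; exact: cmeasurable_adjshift.
split.
- apply: (measurable_rsumZ2 (F := fun x k l =>
    complex.Re (eta (adjshift b0 nu0 x k l) * conjc (V (adjshift b0 nu0 x k l))))).
  by move=> k l; case: (m k l).
- apply: (measurable_rsumZ2 (F := fun x k l =>
    complex.Im (eta (adjshift b0 nu0 x k l) * conjc (V (adjshift b0 nu0 x k l))))).
  by move=> k l; case: (m k l).
Qed.

End PeriodizedMeasurability.

Section CellBound.
Context (R : realType).
Local Notation mu := (@lebesgue_measure R).
Local Notation mu2 := (mu \x mu)%E.
Variables (b0 nu0 A B : R) (V eta : R * R -> R[i]).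
Hypotheses (A0 : 0 < A).

Local Notation S := (periodized_normsq b0 nu0 eta).
Local Notation U := (periodized_normsq b0 nu0 V).
Local Notation M := (best_transfer b0 nu0 V eta).
Local Notation E := (Efun b0 nu0 V eta).
Local Notation dom := (Edom b0 nu0 V eta).

(** Squared distance, on the fibre over [x], between the spreading function and that
of the best Gabor multiplier. *)
Let residual x := nnsumZ2 (fun k l =>
  Normc.normc (eta (adjshift b0 nu0 x k l) - M x * V (adjshift b0 nu0 x k l)) ^+ 2).

Lemma residualE x : (S x < +oo)%E -> (A%:E <= U x <= B%:E)%E ->
  residual x = (fine (S x) -
    Normc.normc (periodized_inner b0 nu0 eta V x) ^+ 2 / fine (U x))%:E.
Proof.
move=> Sx /andP[AU UB]; apply: nnsumZ2_projection => //.
- by apply: le_lt_trans UB _; rewrite ltry.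
- rewrite -lte_fin fineK; first by apply: lt_le_trans AU; rewrite lte_fin.
  by rewrite ge0_fin_numE ?periodized_normsq_ge0//; apply: le_lt_trans UB _; rewrite ltry.
Qed.

(** On the domain of [E] the residual is [S (1 - E)]; off it [S] vanishes, as [U] does
not. *)
Lemma residual_le x : cell b0 nu0 x -> (S x < +oo)%E ->
  (A%:E <= U x <= B%:E)%E ->
  (residual x <= S x * (if x \in dom then `|1 - E x|%:E else 0))%E.
Proof.
move=> cx Sx AUB; rewrite residualE//.
have S0 := periodized_normsq_ge0 b0 nu0 eta x.
have U0 := periodized_normsq_ge0 b0 nu0 V x.
have SK : (fine (S x))%:E = S x by rewrite fineK// ge0_fin_numE.
have UK : (fine (U x))%:E = U x.
  rewrite fineK// ge0_fin_numE//; move/andP: AUB => [_ UB].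
  by apply: le_lt_trans UB _; rewrite ltry.
have u0 : 0 < fine (U x).
  by rewrite -lte_fin UK; move/andP: AUB => [AU _]; apply: lt_le_trans AU; rewrite lte_fin.
have s0 : 0 <= fine (S x) by rewrite -lee_fin SK.
have EdenE : Eden b0 nu0 V eta x = (fine (S x) * fine (U x))%:E.
  by rewrite /Eden -SK -UK.
have [xd|xd] := boolP (x \in dom); last first.
  have := xd; rewrite notin_setE /Edom /= => /not_andP[//|/contrapT].
  rewrite EdenE => -[] /eqP; rewrite mulf_eq0 (gt_eqF u0) orbF => /eqP sz.
  rewrite -SK sz mul0e lee_fin sub0r oppr_le0 divr_ge0 ?sqr_ge0//.
  exact: ltW.
have {}s0 : 0 < fine (S x).
  rewrite lt_neqAle s0 andbT eq_sym; apply/eqP => sz.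
  by move: xd; rewrite inE /Edom /= EdenE sz mul0r => -[].
have EE : E x = Normc.normc (periodized_inner b0 nu0 eta V x) ^+ 2 / fine (U x) /
    fine (S x).
  by rewrite /Efun EdenE /=; field; rewrite !gt_eqF.
rewrite -[leRHS](_ : (fine (S x) * `|1 - E x|)%:E = _); last by rewrite EFinM SK.
rewrite lee_fin; apply: le_trans (ler_wpM2l (ltW s0) (ler_norm _)).
by rewrite EE mulrBr mulr1 mulrCA divff ?gt_eqF// mulr1.
Qed.

Lemma ess_sup_on_ge0 D (u : R * R -> R) : (forall x, 0 <= u x) ->
  (0 <= ess_sup_on mu2 D u)%E.
Proof.
move=> u0; apply: ess_sup_gee.
  pose I01 : set R := [set` `[0, 1[].
  have mI : measurable I01 by exact: measurable_itv.
  have I1 : mu I01 = 1%E.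
    by rewrite lebesgue_measure_itv/= lte_fin ltr01 oppr0 adde0.
  apply: (@lt_le_trans _ _ (mu2 (I01 `*` I01))).
    rewrite product_measure1E//; change (0 < mu I01 * mu I01)%E.
    by rewrite I1 mul1e lte_fin ltr01.
  by apply: le_measure; rewrite ?inE//; exact: measurableX.
by apply: aeW => x; case: ifP => // _; rewrite lee_fin.
Qed.

(** On each fibre of the periodization the residual of the best transfer function
is controlled by the essential supremum; by Young's inequality, replacing the best transfer
function by a periodic [Q] adds a multiple of [B] times their squared distance. *)
Lemma spreading_residual_le (Q : R * R -> R[i]) (e : R) :
  0 < b0 -> 0 < nu0 -> 0 < e -> 0 <= B -> cmeasurable V -> inL2 mu2 eta ->
  cmeasurable Q -> (forall x k l, Q (adjshift b0 nu0 x k l) = Q x) ->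
  {ae mu2, forall x, cell b0 nu0 x -> (A%:E <= U x <= B%:E)%E} ->
  (L2normsq mu2 setT (fun x => eta x - Q x * V x)%R <=
   (1 + e)%:E * (L2normsq mu2 setT eta *
     ess_sup_on mu2 dom (fun x => `|1 - E x|)%R) +
   (1 + e^-1)%:E * (B%:E * L2normsq mu2 (cell b0 nu0) (fun x => Q x - M x)%R))%E.
Proof.
move=> b00 nu00 e0 B0 mV [meta eta2] mQ Qper aeU.
set W := ess_sup_on _ _ _.
have W0 : (0 <= W)%E by exact: ess_sup_on_ge0.
have mcell := measurable_cell b0 nu0.
have mM := cmeasurable_best_transfer b0 nu0 mV meta.
have mF : cmeasurable (fun x => eta x - Q x * V x).
  by apply: cmeasurableB => //; exact: cmeasurableM.
have mS : measurable_fun setT S by exact: measurable_periodized_normsq.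
have S0 := periodized_normsq_ge0 b0 nu0 eta.
have SE := L2normsq_periodize b00 nu00 meta.
have mQM : measurable_fun (cell b0 nu0) (fun x => (Normc.normc (Q x - M x) ^+ 2)%:E).
  by apply: measurable_funTS; apply: measurable_normc_sqE; exact: cmeasurableB.
have QM0 x : cell b0 nu0 x -> (0 <= (Normc.normc (Q x - M x) ^+ 2)%:E)%E.
  by rewrite lee_fin sqr_ge0.
have mSW : measurable_fun (cell b0 nu0) (fun x => S x * W)%E.
  by apply: emeasurable_funM => //; exact: measurable_funTS.
have SW0 x : cell b0 nu0 x -> (0 <= S x * W)%E by move=> _; exact: mule_ge0.
have mBQ := measurable_funeM B%:E mQM.
have BQ0 x : cell b0 nu0 x -> (0 <= B%:E * (Normc.normc (Q x - M x) ^+ 2)%:E)%E.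
  by move=> cx; apply: mule_ge0; [rewrite lee_fin|exact: QM0].
have e1 : 0 <= 1 + e by rewrite addr_ge0// ltW.
have e2 : 0 <= 1 + e^-1 by rewrite addr_ge0// invr_ge0 ltW.
rewrite (L2normsq_periodize b00 nu00 mF) SE.
have i1 : (\int[mu2]_(x in cell b0 nu0) (S x * W) =
    \int[mu2]_(x in cell b0 nu0) S x * W)%E.
  by apply: ge0_integralZr => //; exact: measurable_funTS.
have i2 : (\int[mu2]_(x in cell b0 nu0)
      (B%:E * (Normc.normc (Q x - M x)%R ^+ 2)%:E) =
    B%:E * L2normsq mu2 (cell b0 nu0) (fun x => Q x - M x)%R)%E.
  by apply: ge0_integralZl => //; rewrite lee_fin.
rewrite -i1 -i2 -(@ge0_integralZl _ _ _ mu2 _ mcell _ mSW (1 + e)%:E)//.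
rewrite -(@ge0_integralZl _ _ _ mu2 _ mcell _ mBQ (1 + e^-1)%:E)//.
rewrite -ge0_integralD//; first last.
- exact: measurable_funeM.
- by move=> x cx; apply: mule_ge0; [rewrite lee_fin|exact: BQ0].
- exact: measurable_funeM.
- by move=> x cx; apply: mule_ge0; [rewrite lee_fin|exact: SW0].
have aeS : {ae mu2, forall x, cell b0 nu0 x -> S x \is a fin_num}.
  have iS : mu2.-integrable (cell b0 nu0) S.
    apply/integrableP; split; first exact: measurable_funTS.
    by under eq_integral do rewrite gee0_abs//; rewrite -SE.
  by have := integrable_ae mcell iS; apply: filterS => x; exact.
have aeW : {ae mu2, forall x, ((if x \in dom then `|1 - E x|%:E else 0) <= W)%E}.
  exact: ess_sup_ge.
have aeSU : {ae mu2, forall x, cell b0 nu0 x ->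
    S x \is a fin_num /\ (A%:E <= U x <= B%:E)%E}.
  by apply: ae_imply2 aeS aeU => x h1 h2 cx; split; [exact: h1|exact: h2].
apply: ae_ge0_le_integral => //.
- by move=> x _; exact: periodized_normsq_ge0.
- by apply: measurable_funTS; exact: measurable_periodized_normsq.
- move=> x cx; apply: adde_ge0; apply: mule_ge0; rewrite ?lee_fin//.
    exact: SW0.
  exact: BQ0.
- by apply: emeasurable_funD; exact: measurable_funeM.
apply: ae_imply2 aeSU aeW => x SUx Wx cx; have [Sfin Ux] := SUx cx.
have Sx : (S x < +oo)%E by rewrite -ge0_fin_numE.
apply: (@le_trans _ _ ((1 + e)%:E * residual x +
    (1 + e^-1)%:E * ((Normc.normc (Q x - M x) ^+ 2)%:E * U x))%E).
  have r0 k l : 0 <= Normc.normc (eta (adjshift b0 nu0 x k l) -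
      M x * V (adjshift b0 nu0 x k l)) ^+ 2 by exact: sqr_ge0.
  have v0 k l : 0 <= Normc.normc (V (adjshift b0 nu0 x k l)) ^+ 2 by exact: sqr_ge0.
  rewrite -(nnsumZ2Z (sqr_ge0 _) v0) -(nnsumZ2Z e2); last first.
    by move=> k l; apply: mulr_ge0; exact: sqr_ge0.
  rewrite -(nnsumZ2Z e1 r0) -nnsumZ2D; first last.
  - by move=> k l; apply: mulr_ge0 => //; apply: mulr_ge0; exact: sqr_ge0.
  - by move=> k l; apply: mulr_ge0 => //; exact: sqr_ge0.
  apply: le_nnsumZ2 => k l; rewrite Qper -normc_sqM -(normc_sqN (_ * V _)).
  set v := V _; set a := eta _.
  rewrite (_ : a - Q x * v = (a - M x * v) + - ((Q x - M x) * v)); last by ring.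
  exact: normc_sqD_young.
apply: leeD; (apply: lee_wpmul2l; first by rewrite lee_fin).
  apply: (le_trans (residual_le cx Sx Ux)).
  exact: lee_wpmul2l.
rewrite muleC; apply: lee_wpmul2r; first by rewrite lee_fin sqr_ge0.
by case/andP: Ux.
Qed.

End CellBound.

(** * Error of the best approximation *)

Theorem corollary1 (R : realType) (phi g h : R -> R[i]) (b0 nu0 A B : R)
    (H MM : (R -> R[i]) -> R -> R[i]) (eta : R * R -> R[i])
    (m : int -> int -> R[i]) :
  schwartz phi -> (exists t, phi t != 0) ->
  S0 phi g -> S0 phi h -> inner g h = 1 ->
  0 < b0 -> 0 < nu0 -> 0 < A -> A <= B ->
  {ae leb2, forall x, cell b0 nu0 x ->
    (A%:E <= periodized_normsq b0 nu0 (stft g h) x <= B%:E)%E} ->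
  hilbert_schmidt H -> spreading_function H eta ->
  ell2 m ->
  symplectic_fourier b0 nu0 m (best_transfer b0 nu0 (stft g h) eta) ->
  gabor_multiplier b0 nu0 m g h MM ->
  (HSnormsq (fun f t => H f t - MM f t)%R <=
   L2normsq leb2 setT eta *
   ess_sup_on leb2 (Edom b0 nu0 (stft g h) eta)
     (fun x => `|1 - Efun b0 nu0 (stft g h) eta x|)%R)%E.
Proof.
move=> _ _ [g2 _] [h2 _] _ b00 nu00 A0 AB aeU [[HL2 _ _] _].
move=> [eta2 [kappa [kappa2 Hk] cvg_eta]] _ cvgM gabM.
set W := ess_sup_on _ _ _.
have W0 : (0 <= W)%E by exact: ess_sup_on_ge0.
have B0 : 0 <= B by rewrite (le_trans (ltW A0)).
have mV := cmeasurable_stft g2 h2.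
apply: ge_ereal_sup => _ [e [e2 eON _] <-].
pose P f N t := square_sum (fun k l =>
  m k l * stft g f (k%:~R * b0, l%:~R * nu0) *
  tfshift (k%:~R * b0) (l%:~R * nu0) h t) N.
have P2 f N : inL2 leb (P f N) by exact: inL2_gabor_partial_sum.
apply: lime_le.
  by apply: is_cvg_nneseries => n _ _; exact: L2normsq_ge0.
apply: nearW => K; rewrite big_mkord.
pose Q := gabor_symbol b0 nu0 m.
(* The partial sums P of the multiplier have explicit kernels and spreading
functions; both limits, of P (e n) and of the symbols Q, are taken at once. *)
apply: (le_limit_young
  (Xn := fun N => \sum_(n < K) L2normsq leb setT (fun t => H (e n) t - P (e n) N t)%R)
  (Yn := fun N => L2normsq leb2 setT (fun x => eta x - Q N x * stft g h x)%R)
  (Z := fun N => \sum_(n < K) L2normsq leb setT (fun t => P (e n) N t - MM (e n) t)%R)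
  (W := fun N => (B%:E * L2normsq leb2 (cell b0 nu0)
     (fun x => Q N x - best_transfer b0 nu0 (stft g h) eta x)%R)%E))%E.
- by apply: mule_ge0 => //; exact: L2normsq_ge0.
- move=> c N c0.
  rewrite !ge0_sume_distrr; try by move=> *; exact: L2normsq_ge0.
  rewrite -big_split; apply: lee_sum => n _.
  have [He _] := HL2 _ (e2 n); have [Pe _] := P2 (e n) N.
  have [[Me _] _] := gabM _ (e2 n).
  have := L2normsq_young leb measurableT c0 (cmeasurableB He Pe) (cmeasurableB Pe Me).
  rewrite (_ : (fun _ => _ + _) = (fun t => H (e n) t - MM (e n) t))//.
  by apply/funext => t; ring.
- move=> N; pose k z := kappa z - gabor_kernel g h b0 nu0 m N z.
  have k2 : inL2 leb2 k.
    by apply: inL2B => //; exact: inL2_gabor_kernel.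
  apply: (@le_trans _ _ (L2normsq leb2 setT k)).
    apply: (sum_L2normsq_le_kernel (G := fun n t => H (e n) t - P (e n) N t) K k2 e2).
    + exact: eON.
    + by move=> n; apply: cmeasurableB; [case: (HL2 _ (e2 n))|case: (P2 (e n) N)].
    + move=> n.
      apply: ae_imply2 (Hk _ (e2 n)) (ae_imply2 _ (ae_inL2_section kappa2)
        (ae_inL2_section (inL2_gabor_kernel b0 nu0 m g2 h2 N))) => [t Ht|]; first last.
        by move=> t a b; exact: conj a b.
      move=> [kt Kt].
      rewrite Ht /P gabor_partial_sumE// -[X in _ + X]mulN1r -cintegralZ//; last first.
        exact: cintegrableM.
      rewrite -cintegralD//; [|exact: cintegrableM|]; last first.
        by apply: cintegrableZ => //; exact: cintegrableM.
      by apply: cintegral_eq => s _; rewrite /k; ring.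
  apply: (le_trans (kernel_le_spreading kappa2 eta2 cvg_eta
    (inL2_gabor_kernel b0 nu0 m g2 h2 N) _ _)).
  + by move=> b; exact: cintegrable_diagonal_gabor.
  + rewrite (_ : (fun x => _) = (fun x => Q N x * stft g h x)).
      by apply: cmeasurableM => //; exact: cmeasurable_gabor_symbol.
    by apply/funext => x; exact: fourier_diagonal_gabor_kernel.
  + rewrite le_eqVlt; apply/orP; left; apply/eqP; apply: eq_integral => x _.
    by rewrite fourier_diagonal_gabor_kernel.
- move=> c N c0; apply: (spreading_residual_le A0) => //.
  + exact: cmeasurable_gabor_symbol.
  + by move=> x k l; rewrite /Q gabor_symbol_adjshift.
- have zc : (\sum_(n < K) L2normsq leb setT (fun t => P (e n) N t - MM (e n) t)%R)%E
      @[N --> \oo] --> (\sum_(n < K) 0)%E.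
    apply: cvg_nnesum => n _; last exact: (gabM _ (e2 n)).2.
    by apply: nearW => j; exact: L2normsq_ge0.
  have z0 : (\sum_(n < K) 0)%E = 0%E :> \bar R by rewrite big1.
  by rewrite z0 in zc.
- by rewrite -(mule0 B%:E); apply: cvgeZl => //; exact: cvgM.
Qed.
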